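(* Let $(M,g,J_1,J_2,J_3)$ be a neutral almost hyperhermitian four-manifold and $\mathcal Z$ its hyperbolic twistor space, and let $p:\mathcal Z\to H$ be the natural projection. Then $p$ is $\mathcal J_1$-holomorphic if and only if $M$ is neutral hyperhermitian, and $p$ is $\mathcal J_2$-anti-holomorphic if and only if $M$ is neutral hyperkähler.
   Context: A neutral almost hyperhermitian four-manifold $(M,g,J_1,J_2,J_3)$ is a four-manifold $M$ with a pseudo-Riemannian metric $g$ of signature $(2,2)$ and globally defined endomorphism fields $J_1,J_2,J_3$ of $TM$ with $J_1^2=-\mathrm{Id}$, $J_2^2=J_3^2=\mathrm{Id}$, $J_1J_2=-J_2J_1=J_3$, compatible with $g$: $g(J_1X,J_1Y)=g(X,Y)$, $g(J_aX,J_aY)=-g(X,Y)$ for $a=2,3$. It is neutral hyperhermitian if $J_1,J_2,J_3$ are integrable (their Nijenhuis tensors vanish), and neutral hyperkähler if moreover $J_1,J_2,J_3$ are parallel for the Levi-Civita connection $D$ of $g$. Let $H=\{y=(y_1,y_2,y_3)\in\mathbb R^3: y_1^2-y_2^2-y_3^2=1\}$ and $J_y=y_1J_1+y_2J_2+y_3J_3$ for $y\in H$; these are almost complex structures compatible with $g$ that all induce the same orientation on $M$, and $M$ is taken with this orientation. Hyperbolic twistor space: it is $\pi:\mathcal Z\to M$, $\mathcal Z=\{\sigma=y_1J_1(x)+y_2J_2(x)+y_3J_3(x): x\in M,\ y\in H\}$, with $\pi(\sigma)=x$, contained in the rank $3$ bundle $E=\mathrm{span}(J_1,J_2,J_3)\subset\mathrm{End}(TM)$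 (equivalently, the bundle of all complex structures on tangent spaces of $M$ compatible with the metric and orientation). The bundle $E$ is preserved by $D$. Equip $E$ with the fibre metric $\langle\,,\rangle$ making $J_1,J_2,J_3$ orthogonal with $\langle J_1,J_1\rangle=-1$, $\langle J_2,J_2\rangle=\langle J_3,J_3\rangle=1$, and with the fibrewise vector product $\times$ given by $J_1\times J_2=J_3$, $J_2\times J_3=-J_1$, $J_3\times J_1=J_2$ (antisymmetric, bilinear). The connection $D$ splits $T\mathcal Z$ into horizontal and vertical parts; $X^h_\sigma$ is the horizontal lift of $X\in T_{\pi(\sigma)}M$, and the vertical space at $\sigma$ is $\mathcal V_\sigma=\{V\in E_{\pi(\sigma)}:\langle\sigma,V\rangle=0\}$. For $k=1,2$ the almost complex structure $\mathcal J_k$ on $\mathcal Z$ is $\mathcal J_kX^h_\sigma=(\sigma X)^h_\sigma$, $\mathcal J_kV=(-1)^{k-1}\sigma\times V$ for $V\in\mathcal V_\sigma$. The natural projection $p:\mathcal Z\to H$ is $p(\sigma)=(y_1,y_2,y_3)$ where $\sigma=y_1J_1(x)+y_2J_2(x)+y_3J_3(x)$. The hyperboloid $H$ carries the complex structure $SV=y\times V$, $V\in T_yH$, where $\times$ on $\mathbb R^3$ is the same product in the standard basis ($e_1\times e_2=e_3$, $e_2\times e_3=-e_1$, $e_3\times e_1=e_2$). The map $p$ is $\mathcal J_1$-holomorphic if $p_*\circ\mathcal J_1=S\circ p_*$, and $\mathcal J_2$-anti-holomorphic if $p_*\circ\mathcal J_2=-S\circ p_*$. *)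

(* Defs.v *)
From HB Require Import structures.
From mathcomp Require Import all_boot all_order all_algebra.
From mathcomp Require Import all_classical all_reals all_analysis.
From mathcomp Require Import ring.

Set Implicit Arguments.
Unset Strict Implicit.
Unset Printing Implicit Defensive.
Import Order.TTheory GRing.Theory Num.Theory.
Import numFieldNormedType.Exports.
Local Open Scope classical_set_scope.
Local Open Scope ring_scope.

Section Smooth.
Context {R : realType} {V W : normedModType R}.

(* Only used for finite-dimensional V and open U, where continuity of all the
   directional derivatives is continuity of the Frechet derivative. *)
Fixpoint Ck_on (k : nat) (U : set V) (f : V -> W) : Prop :=
  match k with
  | 0%N => forall u, U u -> {for u, continuous f}
  | k'.+1 => (forall u, U u -> differentiable f u) /\
             (forall v, Ck_on k' U (fun u => 'D_v f u))
  end.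

Definition smooth_on (U : set V) (f : V -> W) := forall k, Ck_on k U f.

Definition curve_at (A : set V) (a w : V) (c : R -> V) : Prop :=
  [/\ c 0 = a, (\forall t \near (0 : R), A (c t)) & is_derive (0 : R) 1 c w].

Definition tangent (A : set V) (a w : V) : Prop := exists c, curve_at A a w c.

(* The differential f_* of a map f that is only meaningful on the submanifold
   A; values of f outside A are never used. *)
Definition pushforward (A : set V) (f : V -> W) (a w : V) : W :=
  xget 0 [set z | exists2 c, curve_at A a w c & is_derive (0 : R) 1 (f \o c) z].

End Smooth.

(* A smooth n-manifold given by an atlas; [chart_inv i] is meaningful on the
   image of the i-th chart only. *)
Record manifold (R : realType) (n : nat) := Manifold {
  carrier :> topologicalType;
  chart_index : Type;
  chart_dom : chart_index -> set carrier;
  chart : chart_index -> carrier -> 'cV[R]_n;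
  chart_inv : chart_index -> 'cV[R]_n -> carrier;
  manifold_hausdorff : hausdorff_space carrier;
  manifold_second_countable : @second_countable carrier;
  chart_dom_open : forall i, open (chart_dom i);
  chart_dom_cover : forall x, exists i, chart_dom i x;
  chart_img_open : forall i, open (chart i @` chart_dom i);
  chartK : forall i x, chart_dom i x -> chart_inv i (chart i x) = x;
  chart_continuous : forall i x, chart_dom i x -> {for x, continuous (chart i)};
  chart_inv_continuous : forall i u, (chart i @` chart_dom i) u ->
    {for u, continuous (chart_inv i)};
  chart_transition_smooth : forall i j,
    smooth_on (chart i @` (chart_dom i `&` chart_dom j))
              (chart j \o chart_inv i)
}.

Section TensorFields.
Context {R : realType} {n : nat} (M : manifold R n).

Definition chart_img (i : chart_index M) : set 'cV[R]_n :=
  chart i @` chart_dom i.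
Definition overlap (i j : chart_index M) : set 'cV[R]_n :=
  chart i @` (chart_dom i `&` chart_dom j).
Definition transition (i j : chart_index M) : 'cV[R]_n -> 'cV[R]_n :=
  chart j \o chart_inv i.

(* A tensor field of rank two is given by its component matrices in the charts,
   T i u being the matrix at the point with coordinates u in the i-th chart. *)
Definition components := chart_index M -> 'cV[R]_n -> 'M[R]_n.

Definition smooth_components (T : components) : Prop :=
  forall i, smooth_on (chart_img i) (T i).

(* A section of End(TM): d tau (T_i v) = T_j (d tau v), tau the transition. *)
Definition endomorphism_field (T : components) : Prop :=
  smooth_components T /\
  forall i j u v, overlap i j u ->
    T j (transition i j u) *m 'D_v (transition i j) u =
    'D_(T i u *m v) (transition i j) u.

(* A section of the bundle of bilinear forms: (v, w) |-> v^T T w. *)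
Definition bilinear_field (T : components) : Prop :=
  smooth_components T /\
  forall i j u v w, overlap i j u ->
    ('D_v (transition i j) u)^T *m T j (transition i j u)
      *m 'D_w (transition i j) u = v^T *m T i u *m w.

End TensorFields.

Section LocalCalculus.
Context {R : realType} {n : nat}.
Implicit Types (G J : 'cV[R]_n -> 'M[R]_n) (X Y : 'cV[R]_n -> 'cV[R]_n).
Implicit Types (u v w z : 'cV[R]_n).

Definition lie_bracket X Y u : 'cV[R]_n := 'D_(X u) Y u - 'D_(Y u) X u.

(* For J^2 = -Id and for J^2 = Id this is the usual Nijenhuis tensor of an
   almost complex, resp. almost product, structure. *)
Definition nijenhuis J X Y u : 'cV[R]_n :=
  let JX := fun u' => J u' *m X u' in
  let JY := fun u' => J u' *m Y u' in
  lie_bracket JX JY u - J u *m lie_bracket JX Y u - J u *m lie_bracket X JY u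
  + J u *m (J u *m lie_bracket X Y u).

Definition basis_vec (l : 'I_n) : 'cV[R]_n := delta_mx l 0.

(* The derivative in the direction v of the function G(w, z), for w and z
   constant in the chart. *)
Definition dform G u v w z : R := (w^T *m 'D_v G u *m z) 0 0.

(* The matrix Gamma(v) of the Levi-Civita connection of the metric G, with
   D_v Y = 'D_v Y + Gamma(v) Y: entry (k, j) is
   \sum_(i, l) 1/2 G^{kl} v^i (d_i G_{jl} + d_j G_{il} - d_l G_{ij}).
   See [christoffel_torsion_free] and [christoffel_metric] below. *)
Definition christoffel G u v : 'M[R]_n :=
  invmx (G u) *m \matrix_(l, j)
    (2^-1 * (dform G u v (basis_vec j) (basis_vec l)
             + dform G u (basis_vec j) v (basis_vec l)
             - dform G u (basis_vec l) v (basis_vec j))).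

(* The Levi-Civita covariant derivative of a section S of End(TM), as a
   function of the value A of S and of its derivative B along v. *)
Definition cov_end G u v (A B : 'M[R]_n) : 'M[R]_n :=
  B + (christoffel G u v *m A - A *m christoffel G u v).

Lemma derive_lincomb (W : normedModType R) (f : 'cV[R]_n -> W) u (c : 'I_n -> R)
    (v : 'I_n -> 'cV[R]_n) : differentiable f u ->
  'D_(\sum_j c j *: v j) f u = \sum_j c j *: 'D_(v j) f u.
Proof.
move=> df; rewrite deriveE // linear_sum; apply: eq_bigr => j _.
by rewrite linearZ /= deriveE.
Qed.

Lemma cV_basis w : w = \sum_j w j 0 *: basis_vec j.
Proof.
apply/matrixP => i j; rewrite ord1 summxE (bigD1 i) //= !mxE eqxx mulr1.
rewrite big1 ?addr0// => k /negPf ki; by rewrite !mxE eq_sym ki mulr0.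
Qed.

Section LeviCivita.
Variables (G : 'cV[R]_n -> 'M[R]_n) (u : 'cV[R]_n).
Hypotheses (dG : differentiable G u) (sG : \forall x \near u, (G x)^T = G x)
  (uG : G u \in unitmx).

Lemma dform_sum1 (c : 'I_n -> R) (a : 'I_n -> 'cV[R]_n) w z :
  dform G u (\sum_j c j *: a j) w z = \sum_j c j * dform G u (a j) w z.
Proof.
rewrite /dform derive_lincomb// mulmx_sumr mulmx_suml summxE.
by apply: eq_bigr => j _; rewrite -scalemxAr -scalemxAl mxE.
Qed.

Lemma dform_sum2 (c : 'I_n -> R) (a : 'I_n -> 'cV[R]_n) v z :
  dform G u v (\sum_j c j *: a j) z = \sum_j c j * dform G u v (a j) z.
Proof.
rewrite /dform linear_sum /= !mulmx_suml summxE; apply: eq_bigr => j _.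
by rewrite linearZ /= -!scalemxAl mxE.
Qed.

Lemma dform_sum3 (c : 'I_n -> R) (a : 'I_n -> 'cV[R]_n) v w :
  dform G u v w (\sum_j c j *: a j) = \sum_j c j * dform G u v w (a j).
Proof.
rewrite /dform mulmx_sumr summxE; apply: eq_bigr => j _.
by rewrite -scalemxAr mxE.
Qed.

Lemma koszul v w z : (z^T *m G u *m (christoffel G u v *m w)) 0 0 =
  2^-1 * (dform G u v w z + dform G u w v z - dform G u z v w).
Proof.
rewrite /christoffel -!mulmxA (mulmxA (G u)) mulmxV// mul1mx mxE.
under eq_bigr => l _.
  have -> : z^T 0 l * ((\matrix_(l0, j) (2^-1 *
     (dform G u v (basis_vec j) (basis_vec l0) +
      dform G u (basis_vec j) v (basis_vec l0) -
      dform G u (basis_vec l0) v (basis_vec j))) *m w) l 0) =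
     2^-1 * (z l 0 * dform G u v w (basis_vec l)
             + z l 0 * dform G u w v (basis_vec l)
             - z l 0 * dform G u (basis_vec l) v w).
    rewrite !mxE -mulrDr -mulrBr mulrCA; congr (_ * _).
    rewrite {2 3 4}(cV_basis w) dform_sum1 dform_sum2 dform_sum3.
    rewrite -big_split /= -sumrB mulr_sumr; apply: eq_bigr => j _.
    by rewrite mxE -mulrDr -mulrBr -mulrA (mulrC (w j 0)).
  over.
rewrite -mulr_sumr sumrB big_split /=; congr (_ * _).
by rewrite -!(dform_sum1, dform_sum3) -!cV_basis.
Qed.

Lemma dform_sym v w z : dform G u v w z = dform G u v z w.
Proof.
have dGv : derivable G u v by exact: diff_derivable.
have DT : ('D_v G u)^T = 'D_v G u.
  rewrite derive_mx//; apply/matrixP => a b; rewrite !mxE.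
  apply: near_eq_derive; apply: filterS sG => x Gx.
  by rewrite -{1}Gx mxE.
have tr (A : 'M[R]_1) : A 0 0 = A^T 0 0 by rewrite mxE.
by rewrite /dform tr !trmx_mul trmxK DT mulmxA.
Qed.

Lemma basis_vec_mul (A : 'M[R]_n) k l :
  ((basis_vec k)^T *m A *m basis_vec l) 0 0 = A k l.
Proof. by rewrite /basis_vec trmx_delta -rowE -colE !mxE. Qed.

Theorem christoffel_torsion_free v w :
  christoffel G u v *m w = christoffel G u w *m v.
Proof.
suff H : G u *m (christoffel G u v *m w) = G u *m (christoffel G u w *m v).
  by rewrite -(mulKmx uG (_ *m w)) H mulKmx.
apply/matrixP => a b; rewrite ord1.
have entry (x : 'cV[R]_n) : x a 0 = ((basis_vec a)^T *m x) 0 0.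
  by rewrite /basis_vec trmx_delta -rowE mxE.
rewrite entry [RHS]entry (mulmxA _ (G u)) [in RHS](mulmxA _ (G u)) !koszul.
by rewrite (dform_sym _ w v) (addrC (dform G u v w _)).
Qed.

Theorem christoffel_metric v :
  'D_v G u = (christoffel G u v)^T *m G u + G u *m christoffel G u v.
Proof.
apply/matrixP => a b; rewrite mxE -!basis_vec_mul.
have tr (A : 'M[R]_1) : A 0 0 = A^T 0 0 by rewrite mxE.
rewrite [X in _ = X + _]tr !trmx_mul !trmxK (nbhs_singleton sG).
rewrite (mulmxA _ (G u) (christoffel _ _ _)) -(mulmxA (_ *m G u)).
rewrite -(mulmxA (G u)) (mulmxA _ (G u)) !koszul -/(dform G u v _ _) (dform_sym v (basis_vec b)).
set p := dform _ _ _ _ _; set q := dform _ _ _ _ _; set r := dform _ _ _ _ _.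
by field.
Qed.

End LeviCivita.

End LocalCalculus.

Definition i1 : 'I_3 := @Ordinal 3 0 isT.
Definition i2 : 'I_3 := @Ordinal 3 1 isT.
Definition i3 : 'I_3 := @Ordinal 3 2 isT.

Section Structures.
Context {R : realType} {M : manifold R 4}.
Implicit Types (g : components M) (J : 'I_3 -> components M).

Definition signature22 (A : 'M[R]_4) : Prop :=
  exists2 P : 'M[R]_4, P \in unitmx &
    P^T *m A *m P = diag_mx (\row_(a < 4) (if (a < 2)%N then 1 else -1)).

Definition neutral_metric g : Prop :=
  bilinear_field g /\
  forall i u, chart_img i u -> (g i u)^T = g i u /\ signature22 (g i u).

Definition neutral_almost_hyperhermitian g J : Prop :=
  [/\ neutral_metric g,
      forall a, endomorphism_field (J a),
      forall i u, chart_img i u ->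
        [/\ J i1 i u *m J i1 i u = - 1%:M,
            J i2 i u *m J i2 i u = 1%:M, J i3 i u *m J i3 i u = 1%:M,
            J i1 i u *m J i2 i u = J i3 i u
          & - (J i2 i u *m J i1 i u) = J i3 i u]
    & forall i u, chart_img i u ->
        [/\ (J i1 i u)^T *m g i u *m J i1 i u = g i u,
            (J i2 i u)^T *m g i u *m J i2 i u = - g i u
          & (J i3 i u)^T *m g i u *m J i3 i u = - g i u]].

Definition integrable_structure (T : components M) : Prop :=
  forall i (X Y : 'cV[R]_4 -> 'cV[R]_4),
    smooth_on (chart_img i) X -> smooth_on (chart_img i) Y ->
    forall u, chart_img i u -> nijenhuis (T i) X Y u = 0.

Definition parallel_structure g (T : components M) : Prop :=
  forall i u v, chart_img i u -> cov_end (g i) u v (T i u) ('D_v (T i) u) = 0.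

Definition neutral_hyperhermitian J : Prop :=
  forall a, integrable_structure (J a).

Definition neutral_hyperkahler g J : Prop :=
  neutral_hyperhermitian J /\ forall a, parallel_structure g (J a).

End Structures.

Section Hyperboloid.
Context {R : realType}.
Implicit Types y z : 'rV[R]_3.

Definition hyperboloid : set 'rV[R]_3 :=
  [set y | y 0 i1 ^+ 2 - y 0 i2 ^+ 2 - y 0 i3 ^+ 2 = 1].

Definition dot3 y z : R :=
  - (y 0 i1 * z 0 i1) + y 0 i2 * z 0 i2 + y 0 i3 * z 0 i3.

(* e1 x e2 = e3, e2 x e3 = - e1, e3 x e1 = e2.  The complex structure of the
   hyperboloid at y is [cross3 y]. *)
Definition cross3 y z : 'rV[R]_3 :=
  (- (y 0 i2 * z 0 i3 - y 0 i3 * z 0 i2)) *: delta_mx 0 i1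
  + (y 0 i3 * z 0 i1 - y 0 i1 * z 0 i3) *: delta_mx 0 i2
  + (y 0 i1 * z 0 i2 - y 0 i2 * z 0 i1) *: delta_mx 0 i3.

End Hyperboloid.

(* Over the domain of the i-th chart, the total space of End(TM) is an open
   subset of 'cV_4 * 'M_4: the pair (u, S) stands for the endomorphism with
   matrix S at the point with coordinates u.  In this bundle chart the twistor
   space is an embedded submanifold of 'cV_4 * 'M_4 and its tangent vectors are
   pairs in 'cV_4 * 'M_4, the first component being the projection to TM. *)
Section Twistor.
Context {R : realType} {M : manifold R 4}.
Variables (g : components M) (J : 'I_3 -> components M) (i : chart_index M).
Implicit Types (u X : 'cV[R]_4) (S V : 'M[R]_4) (s W : 'cV[R]_4 * 'M[R]_4).

Definition frame_comb u (y : 'rV[R]_3) : 'M[R]_4 := \sum_a y 0 a *: J a i u.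

Definition twistor_space : set ('cV[R]_4 * 'M[R]_4) :=
  [set s | chart_img i s.1 /\
           exists2 y, hyperboloid y & s.2 = frame_comb s.1 y].

Definition in_E u S : Prop := exists y, S = frame_comb u y.

Definition E_coord u S : 'rV[R]_3 := xget 0 [set y | S = frame_comb u y].

Definition E_dot u S V : R := dot3 (E_coord u S) (E_coord u V).

Definition E_cross u S V : 'M[R]_4 :=
  frame_comb u (cross3 (E_coord u S) (E_coord u V)).

Definition twistor_proj s : 'rV[R]_3 := E_coord s.1 s.2.

Definition hlift s X : 'cV[R]_4 * 'M[R]_4 :=
  (X, - (christoffel (g i) s.1 X *m s.2 - s.2 *m christoffel (g i) s.1 X)).

Definition vertical s V : Prop := in_E s.1 V /\ E_dot s.1 s.2 V = 0.

(* The almost complex structure on W = X^h + V, X and V being determined by W;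
   [k] is 1 or 2. *)
Definition twistor_J (k : nat) s W : 'cV[R]_4 * 'M[R]_4 :=
  xget 0 [set W' | exists X V,
    [/\ vertical s V, W = hlift s X + (0, V)
      & W' = hlift s (s.2 *m X) + (0, (-1) ^+ k.-1 *: E_cross s.1 s.2 V)]].

End Twistor.

Section Holomorphy.
Context {R : realType} {M : manifold R 4}.
Variables (g : components M) (J : 'I_3 -> components M).

Definition twistor_proj_pushforward (i : chart_index M) :=
  pushforward (twistor_space J i) (twistor_proj J i).

Definition twistor_proj_holomorphic (k : nat) : Prop :=
  forall i s W, twistor_space J i s -> tangent (twistor_space J i) s W ->
    twistor_proj_pushforward i s (twistor_J g J i k s W) =
    cross3 (twistor_proj J i s) (twistor_proj_pushforward i s W).

Definition twistor_proj_antiholomorphic (k : nat) : Prop :=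
  forall i s W, twistor_space J i s -> tangent (twistor_space J i) s W ->
    twistor_proj_pushforward i s (twistor_J g J i k s W) =
    - cross3 (twistor_proj J i s) (twistor_proj_pushforward i s W).

End Holomorphy.

(* Main.v *)
Require Import Defs.
From mathcomp Require Import all_boot all_order all_algebra.
From mathcomp Require Import all_classical all_reals all_analysis.
From mathcomp Require Import ring lra.

Set Implicit Arguments.
Unset Strict Implicit.
Unset Printing Implicit Defensive.
Import Order.TTheory GRing.Theory Num.Theory.
Import numFieldNormedType.Exports.
Local Open Scope classical_set_scope.
Local Open Scope ring_scope.

(** The condition on p can be read off from the connection form of E.

    Over a chart, a point of the twistor space is an endomorphism
    S = y_1 J_1 + y_2 J_2 + y_3 J_3 with y in H, and the covariant derivatives
    of the frame are D_v J_a = sum_b omega(v)_ab J_b: the Levi-Civita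
    connection preserves E.  This holds because D_v J_a is g-skew and
    anticommutes with J_a, and in dimension four the g-skew endomorphisms that
    anticommute with one J_a are spanned by the two others
    ([skew_anticomm_span], [connection_matrix]).

    The differential of p maps a horizontal lift v^h to - y omega(v), and a
    vertical vector to its own coordinates ([hlift_twistor]).  In the equation
    p_* (J_k W) = (-1)^(k-1) y x p_* W the vertical part of W therefore drops
    out, and what remains is the Cauchy-Riemann equation
      y omega(S v) = (-1)^(k-1) y x (y omega(v)),
    called [cr_at] below; it says D_(S v) S = S (D_v S) for k = 1, and
    D_(S v) S = - S (D_v S) for k = 2 ([twistor_proj_cr_at]).

    For a single structure T the equation D_(T v) T = T (D_v T) is
    integrability.  Indeed the Nijenhuis tensor is N(X, Y) = C(X) Y - C(Y) X
    with C(v) = D_(T v) T - T (D_v T), and C is skew, so that a symmetric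
    C(X) Y vanishes ([nijenhuis_cr_defect], [integrable_cr_defect]).

    It remains to pass from y in H to the three basis vectors and back.  The
    equation is quadratic in y, so that holding on H it holds at all basis
    vectors, also at those outside H ([cr_at_basis]).  For k = 1 the equations
    at e_1 and e_2 express the three connection 1-forms by one of them, and
    this is enough to get the equation for all y ([cr_at_all]).  For k = 2 the
    three equations at the basis vectors have signs that force the connection
    form to vanish ([cr_at_anti]), which is parallelism. *)

(** * Skew endomorphisms of a symmetric bilinear form *)

Section SkewForms.
Variables (R : realType) (n : nat) (G : 'M[R]_n).
Implicit Types (A B K L : 'M[R]_n) (x y z : 'cV[R]_n).

Definition bform x y : R := (x^T *m G *m y) 0 0.

Definition form_skew A := (G *m A)^T = - (G *m A).

Lemma formDr x y z : bform x (y + z) = bform x y + bform x z.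
Proof. by rewrite /bform mulmxDr mxE. Qed.

Lemma formNl x y : bform (- x) y = - bform x y.
Proof. by rewrite /bform linearN /= !mulNmx mxE. Qed.

Lemma formNr x y : bform x (- y) = - bform x y.
Proof. by rewrite /bform mulmxN mxE. Qed.

Lemma formZr c x y : bform x (c *: y) = c * bform x y.
Proof. by rewrite /bform -scalemxAr mxE. Qed.

Lemma form_skewD A B : form_skew A -> form_skew B -> form_skew (A + B).
Proof. by rewrite /form_skew mulmxDr linearD /= => -> ->; rewrite opprD. Qed.

Lemma form_skewZ c A : form_skew A -> form_skew (c *: A).
Proof. by rewrite /form_skew -scalemxAr linearZ /= => ->; rewrite scalerN. Qed.

Lemma form_skewN A : form_skew A -> form_skew (- A).
Proof. by rewrite -scaleN1r; exact: form_skewZ. Qed.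

Hypothesis symG : G^T = G.

Lemma form_sym x y : bform x y = bform y x.
Proof.
rewrite /bform -[in LHS](trmxK (x^T *m G *m y)) mxE !trmx_mul trmxK symG.
by rewrite mulmxA.
Qed.

Lemma skew_adj A x y : form_skew A -> bform x (A *m y) = - bform (A *m x) y.
Proof.
move=> sA; rewrite /bform trmx_mul -(mulmxA x^T G) (mulmxA G) -(mulmxA x^T).
have -> : A^T *m G = - (G *m A) by rewrite -sA trmx_mul symG.
by rewrite mulmxN mulNmx [in RHS]mxE opprK !mulmxA.
Qed.

Lemma skew_form_diag A x : form_skew A -> bform x (A *m x) = 0.
Proof.
move=> sA; have := skew_adj x x sA; rewrite [in RHS]form_sym; lra.
Qed.

Lemma form_skew_mul A B : form_skew A -> form_skew B ->
  A *m B = - (B *m A) -> form_skew (A *m B).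
Proof.
rewrite /form_skew => sA sB AB.
have B' : B^T *m G = - (G *m B) by rewrite -sB trmx_mul symG.
rewrite mulmxA trmx_mul sA mulmxN mulmxA B' mulNmx opprK -!mulmxA.
by rewrite -[B *m A]opprK -AB mulmxN.
Qed.

(** If T X Y is symmetric in X and Y while every T X is skew, then
    g(T X Y, Z) is symmetric in the first two arguments and skew in the last
    two, so going around the three arguments twice gives g(T X Y, Z) its own
    opposite. *)
Lemma sym_skew_eq0 (T : 'cV[R]_n -> 'M[R]_n) : G \in unitmx ->
  (forall x, form_skew (T x)) -> (forall x y, T x *m y = T y *m x) ->
  forall x, T x = 0.
Proof.
move=> uG sT cT x.
suff TxG y z : bform z (T x *m y) = 0.
  suff : G *m T x = 0 by move=> GT; rewrite -(mulKmx uG (T x)) GT mulmx0.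
  apply/matrixP => a b; rewrite [RHS]mxE.
  by rewrite -basis_vec_mul (mulmxA _ G) -mulmxA; exact: TxG.
have e1 a b c : bform c (T a *m b) = - bform b (T a *m c).
  by rewrite skew_adj// form_sym.
suff : bform z (T x *m y) = - bform z (T x *m y) by lra.
by rewrite [LHS]e1 cT e1 cT e1 cT opprK.
Qed.

End SkewForms.

(** * Split quaternions acting on a four-dimensional space *)

Section SplitQuaternionBasis.
Variables (R : realType) (G K L : 'M[R]_4) (x : 'cV[R]_4) (k l : R).
Hypotheses (symG : G^T = G) (sK : form_skew G K) (sL : form_skew G L).
Hypotheses (K2 : K *m K = k%:M) (L2 : L *m L = l%:M).
Hypotheses (k0 : k != 0) (l0 : l != 0).
Hypotheses (KL : K *m L = - (L *m K)) (Gx : bform G x x = 1).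

Definition qbasis : 'I_4 -> 'cV[R]_4 :=
  fun j => nth 0 [:: x; K *m x; L *m x; K *m (L *m x)] j.

Lemma K2x (y : 'cV[R]_4) : K *m (K *m y) = k *: y.
Proof. by rewrite mulmxA K2 mul_scalar_mx. Qed.

Lemma L2x (y : 'cV[R]_4) : L *m (L *m y) = l *: y.
Proof. by rewrite mulmxA L2 mul_scalar_mx. Qed.

(** Moving K and L across the form leaves g(x, x) on the diagonal and the value
    g(z, A z) of a skew A elsewhere. *)
Lemma qbasis_gram i j : bform G (qbasis i) (qbasis j) =
  (nth 0 [:: 1; - k; - l; k * l] i) *+ (i == j).
Proof.
have adj := skew_adj symG _ _ sK; have adjL := skew_adj symG _ _ sL.
have sym := form_sym symG.
have xK : bform G x (K *m x) = 0 by exact: skew_form_diag.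
have xL : bform G x (L *m x) = 0 by exact: skew_form_diag.
have xKL : bform G x (K *m (L *m x)) = 0.
  by rewrite mulmxA; apply: skew_form_diag => //; apply: form_skew_mul.
have KK : bform G (K *m x) (K *m x) = - k.
  by rewrite -[LHS]opprK -adj K2x formZr Gx mulr1.
have LL : bform G (L *m x) (L *m x) = - l.
  by rewrite -[LHS]opprK -adjL L2x formZr Gx mulr1.
have KxL : bform G (K *m x) (L *m x) = 0.
  by rewrite -[LHS]opprK -adj xKL oppr0.
have KxKL : bform G (K *m x) (K *m (L *m x)) = 0.
  by rewrite -[LHS]opprK -adj K2x formZr xL mulr0 oppr0.
have LxKL : bform G (L *m x) (K *m (L *m x)) = 0 by exact: skew_form_diag.
have KLKL : bform G (K *m (L *m x)) (K *m (L *m x)) = k * l.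
  by rewrite -[LHS]opprK -adj K2x formZr LL mulrN opprK.
case: i => [[|[|[|[|//]]]] hi]; case: j => [[|[|[|[|//]]]] hj];
  rewrite /qbasis /= ?mulr0n ?mulr1n // sym //.
Qed.

(** The Gram matrix of x, K x, L x, K L x is diagonal with nonzero entries, so
    these four vectors form a basis and g is nondegenerate. *)
Lemma qbasis_separates (y : 'cV[R]_4) :
  bform G x y = 0 -> bform G (K *m x) y = 0 -> bform G (L *m x) y = 0 ->
  bform G (K *m (L *m x)) y = 0 -> y = 0.
Proof.
move=> h0 h1 h2 h3.
pose P := \matrix_(i < 4, j < 4) qbasis j i 0.
have colP j : P *m delta_mx j 0 = qbasis j.
  by rewrite -colE; apply/matrixP => a b; rewrite !mxE ord1.
have gram : P^T *m G *m P =
    diag_mx (\row_i nth 0 [:: 1; - k; - l; k * l] i).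
  apply/matrixP => i j.
  have -> : (P^T *m G *m P) i j = bform G (qbasis i) (qbasis j).
    by rewrite -!colP -basis_vec_mul /bform trmx_mul !mulmxA.
  by rewrite qbasis_gram !mxE.
have : P^T *m G *m P \in unitmx.
  rewrite gram unitmxE det_diag unitfE.
  rewrite !big_ord_recl big_ord0 !mxE /= mulr1 mul1r.
  by rewrite !mulf_neq0 ?oppr_eq0.
rewrite unitmx_mul => /andP[u1 _]; rewrite -(mulKmx u1 y).
suff -> : P^T *m G *m y = 0 by rewrite mulmx0.
apply/matrixP => i j; rewrite ord1 [RHS]mxE.
have -> : (P^T *m G *m y) i 0 = bform G (qbasis i) y.
  by rewrite -colP /bform trmx_mul -3!mulmxA trmx_delta -rowE [RHS]mxE !mulmxA.
by case: i => [[|[|[|[|//]]]] hi].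
Qed.

Lemma qbasis_mx0 (B : 'M[R]_4) : B *m x = 0 -> B *m (K *m x) = 0 ->
  B *m (L *m x) = 0 -> B *m (K *m (L *m x)) = 0 -> form_skew G B -> B = 0.
Proof.
move=> h0 h1 h2 h3 sB.
suff B0 (y : 'cV[R]_4) : B *m y = 0.
  by apply/matrixP => i j; rewrite -basis_vec_mul -mulmxA B0 mulmx0 !mxE.
by apply: qbasis_separates; rewrite (skew_adj symG _ _ sB)
  ?(h0, h1, h2, h3) /bform linear0 !mul0mx mxE oppr0.
Qed.

(** After subtracting its components along L and KL, a skew A that
    anticommutes with K kills x and Kx, hence leaves the plane of Lx and KLx
    stable, and there skewness and anticommutation with K prescribe opposite
    values for the only entry left. *)
Lemma skew_anticomm_span (A : 'M[R]_4) : form_skew G A -> A *m K = - (K *m A) ->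
  exists a b, A = a *: L + b *: (K *m L).
Proof.
move=> sA AK.
have sKL : form_skew G (K *m L) by apply: form_skew_mul.
have adj := skew_adj symG; have sym := form_sym symG.
have gram i j (hi : (i < 4)%N) (hj : (j < 4)%N) :=
  qbasis_gram (Ordinal hi) (Ordinal hj).
have LL : bform G (L *m x) (L *m x) = - l := gram 2%N 2%N isT isT.
have NN : bform G (K *m (L *m x)) (K *m (L *m x)) = k * l :=
  gram 3%N 3%N isT isT.
have LN : bform G (L *m x) (K *m (L *m x)) = 0 := gram 2%N 3%N isT isT.
have NL : bform G (K *m (L *m x)) (L *m x) = 0 := gram 3%N 2%N isT isT.
pose a := - (bform G (L *m x) (A *m x) / l).
pose b := bform G (K *m (L *m x)) (A *m x) / (k * l).
exists a, b; apply/eqP; rewrite -subr_eq0; apply/eqP.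
set B := A - _.
have sB : form_skew G B.
  apply: form_skewD => //; apply: form_skewN.
  by apply: form_skewD; apply: form_skewZ.
have BK (y : 'cV[R]_4) : B *m (K *m y) = - (K *m (B *m y)).
  have LK : L *m K = - (K *m L) by rewrite KL opprK.
  suff /(congr1 (mulmx^~ y)) : B *m K = - (K *m B) by rewrite !mulmxA mulNmx.
  rewrite /B mulmxBl mulmxDl -!scalemxAl AK -(mulmxA K L K) LK mulmxN !scalerN.
  by rewrite mulmxBr mulmxDr -!scalemxAr !opprD !opprK.
have Bx : B *m x = 0.
  have Bxx : bform G x (B *m x) = 0 by exact: skew_form_diag.
  apply: qbasis_separates => //.
  - have h1 : bform G (K *m x) (B *m x) = bform G x (K *m (B *m x)).
      by rewrite (adj _ _ _ sB) BK formNl opprK sym.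
    have := adj _ x (B *m x) sK; lra.
  - rewrite /B mulmxBl mulmxDl -!scalemxAl formDr formNr formDr !formZr.
    rewrite -mulmxA LL LN /a; field.
    exact: l0.
  - rewrite /B mulmxBl mulmxDl -!scalemxAl formDr formNr formDr !formZr.
    rewrite -mulmxA NL NN /b; field.
    by rewrite k0 l0.
have BKx : B *m (K *m x) = 0 by rewrite BK Bx mulmx0 oppr0.
have BLx : B *m (L *m x) = 0.
  apply: qbasis_separates.
  - by rewrite adj// Bx /bform linear0 !mul0mx mxE oppr0.
  - by rewrite adj// BKx /bform linear0 !mul0mx mxE oppr0.
  - exact: skew_form_diag.
  - have h1 : bform G (K *m (L *m x)) (B *m (L *m x)) =
              bform G (L *m x) (K *m (B *m (L *m x))).
      by rewrite (adj _ _ _ sB) BK formNl opprK sym.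
    have := adj _ (L *m x) (B *m (L *m x)) sK; lra.
by apply: qbasis_mx0 => //; rewrite BK BLx mulmx0 oppr0.
Qed.

End SplitQuaternionBasis.

(** * Three-vectors and frames of split quaternions *)

Section ThreeVectors.
Variable R : realType.
Implicit Types y z : 'rV[R]_3.

Lemma big_I3 (T : nmodType) (f : 'I_3 -> T) :
  \sum_a f a = f i1 + f i2 + f i3.
Proof.
by rewrite !big_ord_recl big_ord0 addr0 addrA; do 3 ?congr (_ + _);
  congr f; apply: val_inj.
Qed.

Lemma forall_I3 (P : 'I_3 -> Prop) : P i1 -> P i2 -> P i3 -> forall a, P a.
Proof.
move=> p1 p2 p3 [[|[|[|//]]] ha].
- by rewrite (_ : Ordinal ha = i1)//; exact: val_inj.
- by rewrite (_ : Ordinal ha = i2)//; exact: val_inj.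
- by rewrite (_ : Ordinal ha = i3)//; exact: val_inj.
Qed.

Lemma rV3P y z : y 0 i1 = z 0 i1 -> y 0 i2 = z 0 i2 -> y 0 i3 = z 0 i3 -> y = z.
Proof.
move=> e1 e2 e3; apply/matrixP => i a; rewrite ord1.
by move: a; exact: forall_I3.
Qed.

Lemma cross3E y z :
  ((cross3 y z 0 i1 = - (y 0 i2 * z 0 i3 - y 0 i3 * z 0 i2)) *
   (cross3 y z 0 i2 = y 0 i3 * z 0 i1 - y 0 i1 * z 0 i3) *
   (cross3 y z 0 i3 = y 0 i1 * z 0 i2 - y 0 i2 * z 0 i1))%type.
Proof.
by rewrite /cross3 !mxE /= !(mulr1, mulr0, add0r, addr0).
Qed.

Lemma dot3D y z z' : dot3 y (z + z') = dot3 y z + dot3 y z'.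
Proof. by rewrite /dot3 !mxE; ring. Qed.

Lemma dot3N y z : dot3 y (- z) = - dot3 y z.
Proof. by rewrite /dot3 !mxE; ring. Qed.

Lemma dot3Z c y z : dot3 y (c *: z) = c * dot3 y z.
Proof. by rewrite /dot3 !mxE; ring. Qed.

Lemma dot3_cross y z : dot3 y (cross3 y z) = 0.
Proof. by rewrite /dot3 !cross3E; ring. Qed.

Lemma cross3D y z z' : cross3 y (z + z') = cross3 y z + cross3 y z'.
Proof. by apply: rV3P; rewrite !(cross3E, mxE); ring. Qed.

End ThreeVectors.

Section SplitQuaternionFrame.
Variable (R : realType).
Implicit Types (F A : 'I_3 -> 'M[R]_4) (y z : 'rV[R]_3) (S : 'M[R]_4).

Definition comb F y : 'M[R]_4 := \sum_a y 0 a *: F a.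

Lemma combE F y : comb F y = y 0 i1 *: F i1 + y 0 i2 *: F i2 + y 0 i3 *: F i3.
Proof. by rewrite /comb big_I3. Qed.

Lemma combD F y z : comb F (y + z) = comb F y + comb F z.
Proof.
by rewrite /comb -big_split; apply: eq_bigr => a _; rewrite mxE scalerDl.
Qed.

Lemma combZ F c y : comb F (c *: y) = c *: comb F y.
Proof.
by rewrite /comb scaler_sumr; apply: eq_bigr => a _; rewrite mxE scalerA.
Qed.

Lemma comb_delta F a : comb F (delta_mx 0 a) = F a.
Proof.
rewrite /comb (bigD1 a)//= mxE !eqxx scale1r big1 ?addr0// => b /negPf ba.
by rewrite mxE ba andbF scale0r.
Qed.

Definition split_quaternion_frame F :=
  [/\ F i1 *m F i1 = - 1%:M, F i2 *m F i2 = 1%:M, F i3 *m F i3 = 1%:M,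
      F i1 *m F i2 = F i3 & - (F i2 *m F i1) = F i3].

(** The coordinates of an element of the span of F.  The trace formula is
    defined for every matrix S and is a polynomial in the entries of S and F,
    so that coordinates along a curve can be differentiated. *)
Definition frame_coord F S : 'rV[R]_3 :=
  \row_a ((if a == i1 then - 4^-1 else 4^-1) * \tr (S *m F a)).

Lemma comb_mulmx F y (A : 'M[R]_3) :
  comb F (y *m A) = \sum_a y 0 a *: comb F (row a A).
Proof.
rewrite /comb; under [RHS]eq_bigr do rewrite scaler_sumr.
rewrite exchange_big; apply: eq_bigr => b _; rewrite mxE scaler_suml.
by apply: eq_bigr => a _; rewrite mxE scalerA.
Qed.

Lemma frame_coordD F S S' :
  frame_coord F (S + S') = frame_coord F S + frame_coord F S'.
Proof. by apply/rowP => a; rewrite !mxE mulmxDl linearD mulrDr. Qed.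

Lemma frame_coordZ F c S : frame_coord F (c *: S) = c *: frame_coord F S.
Proof. by apply/rowP => a; rewrite !mxE -scalemxAl linearZ /= mulrCA. Qed.

Section Frame.
Variable F : 'I_3 -> 'M[R]_4.
Hypothesis hF : split_quaternion_frame F.

Lemma frame_table :
  ((F i1 *m F i1 = - 1%:M) * (F i2 *m F i2 = 1%:M) * (F i3 *m F i3 = 1%:M) *
   (F i1 *m F i2 = F i3) * (F i2 *m F i1 = - F i3) *
   (F i1 *m F i3 = - F i2) * (F i3 *m F i1 = F i2) *
   (F i2 *m F i3 = - F i1) * (F i3 *m F i2 = F i1))%type.
Proof.
have [h11 h22 h33 h12 h21] := hF.
have h21' : F i2 *m F i1 = - F i3 by rewrite -h21 opprK.
do !split=> //.
- by rewrite -h12 mulmxA h11 mulNmx mul1mx.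
- by rewrite -h21 mulNmx -mulmxA h11 mulmxN mulmx1 opprK.
- by rewrite -h21 mulmxN mulmxA h22 mul1mx.
- by rewrite -h12 -mulmxA h22 mulmx1.
Qed.

(** For orthogonal y and z the composition of endomorphisms is thus the vector
    product: this is how the complex structure of the fibres acts. *)
Lemma comb_mul y z :
  comb F y *m comb F z = (dot3 y z)%:M + comb F (cross3 y z).
Proof.
rewrite !combE !cross3E !mulmxDl !mulmxDr -!scalemxAl -!scalemxAr !frame_table.
rewrite -scalemx1 /dot3; apply/matrixP => i j; rewrite !mxE; ring.
Qed.

(** Each member of the frame is the product of two anticommuting ones. *)
Lemma frame_trace0 a : \tr (F a) = 0.
Proof.
have tr0 (A B : 'M[R]_4) : A *m B = - (B *m A) -> \tr (A *m B) = 0 :> R.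
  by move=> /(congr1 mxtrace); rewrite linearN /= [in RHS]mxtrace_mulC; lra.
move: a; apply: forall_I3.
- have -> : F i1 = F i3 *m F i2 by rewrite frame_table.
  by rewrite tr0// !frame_table opprK.
- have -> : F i2 = F i3 *m F i1 by rewrite frame_table.
  by rewrite tr0// !frame_table opprK.
- have -> : F i3 = F i1 *m F i2 by rewrite frame_table.
  by rewrite tr0// !frame_table opprK.
Qed.

Lemma comb_trace0 y : \tr (comb F y) = 0.
Proof.
rewrite /comb linear_sum big1// => a _.
by rewrite linearZ /= frame_trace0 mulr0.
Qed.

Lemma frame_coordK y : frame_coord F (comb F y) = y.
Proof.
apply/rowP => a; rewrite mxE -(comb_delta F a) comb_mul.
rewrite linearD /= comb_trace0 mxtrace_scalar addr0 -mulr_natl.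
by move: a; apply: forall_I3; rewrite /dot3 !mxE /=; field.
Qed.

Lemma comb_inj : injective (comb F).
Proof. exact: (can_inj frame_coordK). Qed.

Lemma frame_skew (G : 'M[R]_4) a : G^T = G ->
  form_skew G (F i1) -> form_skew G (F i2) -> form_skew G (F a).
Proof.
move=> sG s1 s2; move: a; apply: forall_I3 => //.
by rewrite -frame_table; apply: form_skew_mul => //; rewrite !frame_table opprK.
Qed.

End Frame.

Section Connection.
Variables (G : 'M[R]_4) (F A : 'I_3 -> 'M[R]_4) (x : 'cV[R]_4).
Hypotheses (symG : G^T = G) (Gx : bform G x x = 1).
Hypotheses (hF : split_quaternion_frame F) (sF : forall a, form_skew G (F a)).
Hypotheses (sA : forall a, form_skew G (A a)).
Hypotheses (A11 : A i1 *m F i1 + F i1 *m A i1 = 0)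
  (A22 : A i2 *m F i2 + F i2 *m A i2 = 0)
  (A12 : A i1 *m F i2 + F i1 *m A i2 = A i3)
  (A21 : - (A i2 *m F i1 + F i2 *m A i1) = A i3).

(** The hypotheses are the relations of the frame differentiated by a derivation
    with values A.  Those for the squares put A i1 and A i2 in the span of F, by
    [skew_anticomm_span]; the two expressions of A i3, from F i1 F i2 and from
    - F i2 F i1, must then agree, which identifies the coefficient of F i2 in
    A i1 with that of F i1 in A i2. *)
Lemma connection_matrix : exists a b c : R,
  [/\ A i1 = a *: F i2 + b *: F i3, A i2 = a *: F i1 + c *: F i3
    & A i3 = b *: F i1 - c *: F i2].
Proof.
have tb := frame_table hF.
have anti (B C : 'M[R]_4) : B *m C + C *m B = 0 -> B *m C = - (C *m B).
  by move=> BC; apply/eqP; rewrite -addr_eq0 BC.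
have [a [b Ea]] : exists a b, A i1 = a *: F i2 + b *: (F i1 *m F i2).
  apply: (@skew_anticomm_span R G (F i1) (F i2) x (-1) 1) => //;
    rewrite ?oppr_eq0 ?oner_eq0// ?tb ?raddfN ?opprK//; exact: anti.
have [d [e Ed]] : exists a b, A i2 = a *: F i1 + b *: (F i2 *m F i1).
  apply: (@skew_anticomm_span R G (F i2) (F i1) x 1 (-1)) => //;
    rewrite ?oppr_eq0 ?oner_eq0// ?tb ?raddfN ?opprK//; exact: anti.
rewrite !tb in Ea Ed.
exists a, b, (- e).
have E1 : A i3 = (a - d)%:M + b *: F i1 + e *: F i2.
  rewrite -A12 Ea Ed !mulmxDl !mulmxDr -!scalemxAl -!scalemxAr mulmxN !tb.
  by apply/matrixP => i j; rewrite !mxE; ring.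
have E2 : A i3 = (d - a)%:M + b *: F i1 + e *: F i2.
  rewrite -A21 Ea Ed !mulmxDl !mulmxDr -!scalemxAl -!scalemxAr mulNmx !tb.
  by apply/matrixP => i j; rewrite !mxE; ring.
have ad : a = d.
  have := E1; rewrite E2 => /(congr1 (fun B : 'M[R]_4 => B 0 0)).
  by rewrite !mxE /=; lra.
split.
- exact: Ea.
- by rewrite Ed ad scalerN scaleNr.
- by rewrite E1 ad subrr scaleNr opprK raddf0 add0r.
Qed.

End Connection.

End SplitQuaternionFrame.

(** * Derivatives of matrix-valued maps *)

Section MatrixCalculus.
Variables (R : realType) (V : normedModType R).
Implicit Types (x v : V).

Lemma is_derive_mxP m n (F : V -> 'M[R]_(m, n)) (dF : 'M[R]_(m, n)) x v :
  is_derive x v F dF <->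
  forall i j, is_derive x v (fun t => F t i j : R) (dF i j).
Proof.
split=> [[Fx <-] i j|dFij].
  by split; [exact: (derivable_mxP _ _ _).1|rewrite derive_mx// mxE].
have Fx : derivable F x v by apply/derivable_mxP => i j; have [] := dFij i j.
split => //; rewrite derive_mx//; apply/matrixP => i j.
by rewrite mxE; have [_ ->] := dFij i j.
Qed.

Lemma is_derive_bigsum n (f : 'I_n -> V -> R) (df : 'I_n -> R) x v :
  (forall i, is_derive x v (f i) (df i)) ->
  is_derive x v (fun t => \sum_i f i t) (\sum_i df i).
Proof.
move=> h; have := is_derive_sum h; congr is_derive.
by apply/funext => t; rewrite fct_sumE.
Qed.

Lemma is_derive_mul (f h : V -> R) (df dh : R) x v :
  is_derive x v f df -> is_derive x v h dh ->
  is_derive x v (fun t => f t * h t) (df * h x + f x * dh).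
Proof.
move=> fx hx; apply: is_derive_eq; rewrite addrC; congr (_ + _).
by rewrite mulrC.
Qed.

Lemma is_derive_mulmx m n p (F : V -> 'M[R]_(m, n)) (H : V -> 'M[R]_(n, p))
    (dF : 'M[R]_(m, n)) (dH : 'M[R]_(n, p)) x v :
  is_derive x v F dF -> is_derive x v H dH ->
  is_derive x v (fun t => F t *m H t) (dF *m H x + F x *m dH).
Proof.
move=> /is_derive_mxP Fx /is_derive_mxP Hx; apply/is_derive_mxP => i j.
rewrite 3!mxE -big_split /=; under eq_fun do rewrite mxE.
by apply: is_derive_bigsum => k; exact: is_derive_mul.
Qed.

Lemma is_derive_scalemx m n (k : V -> R) (F : V -> 'M[R]_(m, n)) (dk : R)
    (dF : 'M[R]_(m, n)) x v :
  is_derive x v k dk -> is_derive x v F dF ->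
  is_derive x v (fun t => k t *: F t) (dk *: F x + k x *: dF).
Proof.
move=> kx /is_derive_mxP Fx; apply/is_derive_mxP => i j.
by rewrite 3!mxE; under eq_fun do rewrite mxE; exact: is_derive_mul.
Qed.

Lemma is_derive_sum_scalemx m n q (k : 'I_q -> V -> R)
    (F : 'I_q -> V -> 'M[R]_(m, n)) (dk : 'I_q -> R)
    (dF : 'I_q -> 'M[R]_(m, n)) x v :
  (forall a, is_derive x v (k a) (dk a)) ->
  (forall a, is_derive x v (F a) (dF a)) ->
  is_derive x v (fun t => \sum_a k a t *: F a t)
    (\sum_a dk a *: F a x + \sum_a k a x *: dF a).
Proof.
move=> kx Fx; rewrite -big_split /=.
have h a := is_derive_scalemx (kx a) (Fx a).
have := is_derive_sum h; congr is_derive.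
by apply/funext => t; rewrite fct_sumE.
Qed.

Lemma is_derive_trmx m n (F : V -> 'M[R]_(m, n)) (dF : 'M[R]_(m, n)) x v :
  is_derive x v F dF -> is_derive x v (fun t => (F t)^T) dF^T.
Proof.
move=> /is_derive_mxP Fx; apply/is_derive_mxP => i j.
by rewrite mxE; under eq_fun do rewrite mxE; exact: Fx.
Qed.

Lemma is_derive_mxtrace n (F : V -> 'M[R]_n) (dF : 'M[R]_n) x v :
  is_derive x v F dF -> is_derive x v (fun t => \tr (F t)) (\tr dF).
Proof.
by move=> /is_derive_mxP Fx; apply: is_derive_bigsum => i; exact: Fx.
Qed.

End MatrixCalculus.

Section CurveCalculus.
Variable R : realType.

Lemma is_derive_curve_comp (V W : normedModType R) (f : V -> W) (c : R -> V)
    (t : R) (w : V) :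
  differentiable f (c t) -> is_derive t 1 c w ->
  is_derive t 1 (f \o c) ('D_w f (c t)).
Proof.
move=> dfc [/derivable1_diffP dc <-].
have dcomp : differentiable (f \o c) t by exact: differentiable_comp.
split; first exact/diff_derivable.
by rewrite deriveE// diff_comp//= deriveE// deriveE.
Qed.

Lemma is_derive_pair (V W : normedModType R) (c : R -> V) (d : R -> W) (t : R)
    (v : V) (w : W) :
  is_derive t 1 c v -> is_derive t 1 d w ->
  is_derive t 1 (fun s => (c s, d s)) (v, w).
Proof.
move=> [/derivable1_diffP dc <-] [/derivable1_diffP dd <-].
have dp : differentiable (fun s => (c s, d s)) t by exact: differentiable_pair.
split; first exact/diff_derivable.
by rewrite !deriveE// diff_pair.
Qed.

Lemma is_derive_fst (V W : normedModType R) (c : R -> V * W) (t : R) w :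
  is_derive t 1 c w -> is_derive t 1 (fun s => (c s).1) w.1.
Proof.
move=> cw.
have d1 : differentiable (fst : V * W -> V) (c t).
  apply: linear_differentiable => -[a b]; exact: cvg_fst.
have := is_derive_curve_comp d1 cw.
rewrite deriveE// diff_lin//= => -[a b]; exact: cvg_fst.
Qed.

Lemma is_derive_snd (V W : normedModType R) (c : R -> V * W) (t : R) w :
  is_derive t 1 c w -> is_derive t 1 (fun s => (c s).2) w.2.
Proof.
move=> cw.
have d1 : differentiable (snd : V * W -> W) (c t).
  apply: linear_differentiable => -[a b]; exact: cvg_snd.
have := is_derive_curve_comp d1 cw.
rewrite deriveE// diff_lin//= => -[a b]; exact: cvg_snd.
Qed.

End CurveCalculus.

(** * Covariant derivatives and the Nijenhuis tensor *)

(* Identities in the additive group of matrices, products being atoms. *)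
Ltac mx_abel := apply/matrixP => ? ?; rewrite !mxE; ring.

Section CovariantDerivative.
Variables (R : realType) (n : nat) (G : 'cV[R]_n -> 'M[R]_n) (u : 'cV[R]_n).
Hypotheses (dG : differentiable G u) (sG : \forall x \near u, (G x)^T = G x)
  (uG : G u \in unitmx).
Implicit Types (S T : 'cV[R]_n -> 'M[R]_n) (v w : 'cV[R]_n).

Definition cov T v : 'M[R]_n := cov_end G u v (T u) ('D_v T u).

Lemma mulmx_ext (A B : 'M[R]_n) :
  (forall w : 'cV[R]_n, A *m w = B *m w) -> A = B.
Proof.
move=> AB; apply/matrixP => i j.
by rewrite -(basis_vec_mul A) -(basis_vec_mul B) -!mulmxA AB.
Qed.

(** By symmetry of the Christoffel symbols, linearity in the direction is
    linearity of a matrix product. *)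
Lemma christoffelD v w :
  christoffel G u (v + w) = christoffel G u v + christoffel G u w.
Proof.
have tf := christoffel_torsion_free dG sG uG.
by apply: mulmx_ext => z; rewrite mulmxDl tf mulmxDr (tf v z) (tf w z).
Qed.

Lemma christoffelZ c v : christoffel G u (c *: v) = c *: christoffel G u v.
Proof.
have tf := christoffel_torsion_free dG sG uG.
by apply: mulmx_ext => z; rewrite -scalemxAl tf -scalemxAr (tf v z).
Qed.

Lemma derive_diff T v : differentiable T u -> is_derive u v T ('D_v T u).
Proof. by move=> dT; apply: derivableP; exact: diff_derivable. Qed.

Lemma covD T v w : differentiable T u -> cov T (v + w) = cov T v + cov T w.
Proof.
move=> dT; rewrite /cov /cov_end christoffelD !deriveE// linearD /=.
by rewrite mulmxDl mulmxDr; mx_abel.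
Qed.

Lemma covZ T c v : differentiable T u -> cov T (c *: v) = c *: cov T v.
Proof.
move=> dT; rewrite /cov /cov_end christoffelZ !deriveE// linearZ /=.
by rewrite -scalemxAl -scalemxAr -scalerBr -scalerDr.
Qed.

Lemma cov_near S T v : (\forall x \near u, S x = T x) -> cov S v = cov T v.
Proof.
by move=> ST; rewrite /cov (near_eq_derive _ ST) (nbhs_singleton ST).
Qed.

Lemma cov_scalar c v : cov (fun=> c%:M) v = 0.
Proof.
rewrite /cov /cov_end derive_cst add0r mul_mx_scalar mul_scalar_mx.
by rewrite subrr.
Qed.

Lemma covN T v : differentiable T u -> cov (fun x => - T x) v = - cov T v.
Proof.
move=> dT; rewrite /cov /cov_end.
have -> : 'D_v (fun x => - T x) u = - 'D_v T u.
  by rewrite -deriveN//; exact: diff_derivable.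
by rewrite mulmxN mulNmx; mx_abel.
Qed.

Lemma cov_mul S T v : differentiable S u -> differentiable T u ->
  cov (fun x => S x *m T x) v = cov S v *m T u + S u *m cov T v.
Proof.
move=> dS dT; rewrite /cov /cov_end.
have [_ ->] := is_derive_mulmx (derive_diff v dS) (derive_diff v dT).
rewrite !(mulmxDl, mulmxDr, mulmxN, mulNmx, mulmxA).
by mx_abel.
Qed.

(** The Levi-Civita connection is metric, so it differentiates the identity
    that expresses the skewness of T. *)
Lemma cov_skew T v : differentiable T u ->
  (\forall x \near u, form_skew (G x) (T x)) -> form_skew (G u) (cov T v).
Proof.
move=> dT sT; set Gam := christoffel G u v.
pose P := 'D_v G u *m T u + G u *m 'D_v T u.
have Pder : is_derive u v (fun x => G x *m T x) P.
  exact: is_derive_mulmx (derive_diff v dG) (derive_diff v dT).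
have PT : P^T = - P.
  have [_ <-] := is_derive_trmx Pder.
  rewrite (near_eq_derive (g := fun x => - (G x *m T x)))//.
  by rewrite deriveN; [case: Pder => _ ->|case: Pder].
have := nbhs_singleton sT; rewrite /form_skew => GT.
have -> : G u *m cov T v = P - Gam^T *m (G u *m T u) - (G u *m T u) *m Gam.
  rewrite /P (christoffel_metric dG sG uG) -/Gam /cov /cov_end -/Gam.
  by rewrite !(mulmxDl, mulmxDr, mulmxN, mulNmx, mulmxA); mx_abel.
rewrite linearB linearB /= trmx_mul trmxK (trmx_mul _ Gam) PT GT.
by rewrite mulmxN mulNmx; mx_abel.
Qed.

(** Measures how far the Cauchy-Riemann equation D_(T v) T = T (D_v T) is from
    being satisfied. *)
Definition cr_defect T v : 'M[R]_n := cov T (T u *m v) - T u *m cov T v.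

(** As D is torsion-free, it may replace the coordinate derivatives in all four
    brackets; the derivatives of X and Y then cancel, and those of T remain. *)
Lemma nijenhuis_cr_defect T X Y : differentiable T u ->
  differentiable X u -> differentiable Y u ->
  nijenhuis T X Y u = cr_defect T (X u) *m Y u - cr_defect T (Y u) *m X u.
Proof.
move=> dT dX dY.
have prod Z v : differentiable Z u ->
    'D_v (fun x => T x *m Z x) u = 'D_v T u *m Z u + T u *m 'D_v Z u.
  move=> dZ; have dZv : is_derive u v Z ('D_v Z u).
    by apply: derivableP; exact: diff_derivable.
  by have [_ ->] := is_derive_mulmx (derive_diff v dT) dZv.
have alg (t : 'M[R]_n) (x y : 'cV[R]_n) (DT Gam : 'cV[R]_n -> 'M[R]_n)
    (DX DY : 'cV[R]_n -> 'cV[R]_n) :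
    (forall v w, Gam v *m w = Gam w *m v) ->
    let C v := DT (t *m v) + (Gam (t *m v) *m t - t *m Gam (t *m v))
               - t *m (DT v + (Gam v *m t - t *m Gam v)) in
    DT (t *m x) *m y + t *m DY (t *m x) - (DT (t *m y) *m x + t *m DX (t *m y))
    - t *m (DY (t *m x) - (DT y *m x + t *m DX y))
    - t *m (DT x *m y + t *m DY x - DX (t *m y))
    + t *m (t *m (DY x - DX y)) = C x *m y - C y *m x.
  move=> tf; rewrite /= !(mulmxDl, mulmxDr, mulmxN, mulNmx) -!mulmxA.
  rewrite (tf (t *m x) (t *m y)) (tf (t *m x) y) (tf (t *m y) x) (tf x y).
  by mx_abel.
rewrite /nijenhuis /lie_bracket !prod//.
exact: (alg (T u) (X u) (Y u) (fun v => 'D_v T u) (christoffel G u)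
  (fun v => 'D_v X u) (fun v => 'D_v Y u) (christoffel_torsion_free dG sG uG)).
Qed.

(** Differentiating T T = c shows that T anticommutes with its covariant
    derivatives, so that their product with T is again skew. *)
Lemma cr_defect_skew T v c : differentiable T u ->
  (\forall x \near u, form_skew (G x) (T x)) ->
  (\forall x \near u, T x *m T x = c%:M) -> form_skew (G u) (cr_defect T v).
Proof.
move=> dT sT T2.
apply: form_skewD; first exact: cov_skew.
apply: form_skewN; apply: form_skew_mul.
- exact: nbhs_singleton sG.
- exact: nbhs_singleton sT.
- exact: cov_skew.
- apply/eqP; rewrite -addr_eq0 addrC -cov_mul//.
  by rewrite (cov_near (T := fun=> c%:M)) ?cov_scalar.
Qed.

End CovariantDerivative.

Lemma smooth_on_cst (R : realType) (V W : normedModType R) (U : set V) (a : W) :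
  smooth_on U (cst a).
Proof.
move=> k; elim: k a => [|k IHk] a /= => [u _|]; first exact: cst_continuous.
split => [u _|v]; first exact: differentiable_cst.
rewrite (_ : (fun u => _) = cst 0)//.
by apply/funext => u; rewrite derive_cst.
Qed.

Lemma smooth_on_differentiable (R : realType) (V W : normedModType R)
    (U : set V) (f : V -> W) u : smooth_on U f -> U u -> differentiable f u.
Proof. by move=> /(_ 1%N)[df _]; exact: df. Qed.


(** * The Cauchy-Riemann equation as a quadratic equation on three-space *)

(** Here om is the connection form of E in the frame F: row a of om v is formed
    by the coordinates of D_v F_a. *)
Section HolomorphyAlgebra.
Variables (R : realType) (F : 'I_3 -> 'M[R]_4) (om : 'cV[R]_4 -> 'M[R]_3).
Hypothesis hF : split_quaternion_frame F.
Hypotheses (omD : forall v w, om (v + w) = om v + om w)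
  (omZ : forall c v, om (c *: v) = c *: om v).
Hypothesis om_so : forall v, exists a b c : R, forall y : 'rV[R]_3,
  [/\ (y *m om v) 0 i1 = y 0 i2 * a + y 0 i3 * b,
      (y *m om v) 0 i2 = y 0 i1 * a - y 0 i3 * c
    & (y *m om v) 0 i3 = y 0 i1 * b + y 0 i2 * c].
Implicit Types (y : 'rV[R]_3) (v : 'cV[R]_4).

(** The equation D_(S v) S = e S (D_v S) for S = comb F y, written in
    coordinates; y is treated as a constant, since only the derivatives of the
    frame contribute. *)
Definition cr_at (e : R) y :=
  forall v, y *m om (comb F y *m v) = e *: cross3 y (y *m om v).

Let a v := om v i1 i2.
Let b v := om v i1 i3.
Let c v := om v i2 i3.

Lemma row_om y v :
  (((y *m om v) 0 i1 = (y 0 i2 * a v + y 0 i3 * b v)%R) *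
   ((y *m om v) 0 i2 = (y 0 i1 * a v - y 0 i3 * c v)%R) *
   ((y *m om v) 0 i3 = (y 0 i1 * b v + y 0 i2 * c v)%R))%type.
Proof.
have [a' [b' [c' h]]] := om_so v.
have entry k l : om v k l = ((delta_mx 0 k : 'rV[R]_3) *m om v) 0 l.
  by rewrite -rowE mxE.
have [h11 h12 h13] := h (delta_mx 0 i1); have [_ _ h23] := h (delta_mx 0 i2).
rewrite /a /b /c !entry h12 h13 h23; have [-> -> ->] := h y; rewrite !mxE /=.
by do !split; ring.
Qed.

Lemma dot3_row_om y v : dot3 y (y *m om v) = 0.
Proof. by rewrite /dot3 !row_om; ring. Qed.

(** The coordinates of [cr_at] as polynomials in y, for linear arithmetic. *)
Definition cr_eqs (e : R) y :=
  forall v,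
  let s (f : 'cV[R]_4 -> R) :=
    y 0 i1 * f (F i1 *m v) + y 0 i2 * f (F i2 *m v) + y 0 i3 * f (F i3 *m v) in
  [/\ y 0 i2 * s a + y 0 i3 * s b =
      - e * (y 0 i2 * (y 0 i1 * b v + y 0 i2 * c v)
             - y 0 i3 * (y 0 i1 * a v - y 0 i3 * c v)),
      y 0 i1 * s a - y 0 i3 * s c =
      e * (y 0 i3 * (y 0 i2 * a v + y 0 i3 * b v)
             - y 0 i1 * (y 0 i1 * b v + y 0 i2 * c v))
    & y 0 i1 * s b + y 0 i2 * s c =
      e * (y 0 i1 * (y 0 i1 * a v - y 0 i3 * c v)
             - y 0 i2 * (y 0 i2 * a v + y 0 i3 * b v))].

Lemma cr_atE e y : cr_at e y <-> cr_eqs e y.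
Proof.
have sE k l v : om (comb F y *m v) k l = y 0 i1 * om (F i1 *m v) k l
    + y 0 i2 * om (F i2 *m v) k l + y 0 i3 * om (F i3 *m v) k l.
  by rewrite combE !mulmxDl -!scalemxAl !omD !omZ !mxE.
have eqs v : y *m om (comb F y *m v) = e *: cross3 y (y *m om v) <->
   [/\ (y *m om (comb F y *m v)) 0 i1 = e * cross3 y (y *m om v) 0 i1,
       (y *m om (comb F y *m v)) 0 i2 = e * cross3 y (y *m om v) 0 i2
     & (y *m om (comb F y *m v)) 0 i3 = e * cross3 y (y *m om v) 0 i3].
  split=> [->|[e1 e2 e3]]; first by rewrite !mxE.
  by apply: rV3P; rewrite ?e1 ?e2 ?e3 [RHS]mxE.
by split => h v; have := h v; rewrite eqs !cross3E !row_om /a /b /c !sE;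
  case=> h1 h2 h3; split; move: h1 h2 h3 => /=; rewrite ?mulNr ?mulrN.
Qed.

Let e1 : 'rV[R]_3 := delta_mx 0 i1.
Let e2 : 'rV[R]_3 := delta_mx 0 i2.
Let e3 : 'rV[R]_3 := delta_mx 0 i3.
(* Rational points of the hyperboloid, from 5^2 = 4^2 + 3^2. *)
Let h12 (t : R) : 'rV[R]_3 := (5 / 4) *: e1 + (t * (3 / 4)) *: e2.
Let h13 (t : R) : 'rV[R]_3 := (5 / 4) *: e1 + (t * (3 / 4)) *: e3.

Lemma hyperboloid_points : [/\ hyperboloid e1, hyperboloid (h12 1),
  hyperboloid (h12 (-1)), hyperboloid (h13 1) & hyperboloid (h13 (-1))].
Proof. by split; rewrite /hyperboloid /= !mxE /=; field. Qed.

(** The difference of the two sides is a quadratic form in y.  It vanishes at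
    e1 and at 5/4 e1 + 3/4 e2 and 5/4 e1 - 3/4 e2; adding the last two values
    cancels the mixed term and leaves the value at e2. *)
Lemma cr_at_basis e : (forall y, hyperboloid y -> cr_at e y) ->
  [/\ cr_at e e1, cr_at e e2 & cr_at e e3].
Proof.
move=> hH; have [H1 H2 H3 H4 H5] := hyperboloid_points.
split; first exact: hH.
- apply/cr_atE => v.
  have [] := (cr_atE _ _).1 (hH _ H1) v; have [] := (cr_atE _ _).1 (hH _ H2) v.
  have [] := (cr_atE _ _).1 (hH _ H3) v.
  by rewrite !mxE /= => *; split; lra.
- apply/cr_atE => v.
  have [] := (cr_atE _ _).1 (hH _ H1) v; have [] := (cr_atE _ _).1 (hH _ H4) v.
  have [] := (cr_atE _ _).1 (hH _ H5) v.
  by rewrite !mxE /= => *; split; lra.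
Qed.

Lemma cr_at_e1 e : cr_at e e1 ->
  forall v, a (F i1 *m v) = - (e * b v) /\ b (F i1 *m v) = e * a v.
Proof.
by move=> /cr_atE h v; have [] := h v; rewrite !mxE /= => *; split; lra.
Qed.

Lemma cr_at_e2 e : cr_at e e2 ->
  forall v, a (F i2 *m v) = - (e * c v) /\ c (F i2 *m v) = - (e * a v).
Proof.
by move=> /cr_atE h v; have [] := h v; rewrite !mxE /= => *; split; lra.
Qed.

Lemma cr_at_e3 e : cr_at e e3 ->
  forall v, b (F i3 *m v) = - (e * c v) /\ c (F i3 *m v) = - (e * b v).
Proof.
by move=> /cr_atE h v; have [] := h v; rewrite !mxE /= => *; split; lra.
Qed.

Lemma om12N v : a (- v) = - a v.
Proof. by rewrite /a -scaleN1r omZ mxE mulN1r. Qed.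

(** The equations at e1 and e2 give b = - a o F_1 and c = - a o F_2.  With the
    multiplication table of F, all entries of om (F_j v) become values of a, b,
    c at v and of a at F_3 v, and the equation at y is an identity in them. *)
Lemma cr_at_all : cr_at 1 e1 -> cr_at 1 e2 -> forall y, cr_at 1 y.
Proof.
move=> /cr_at_e1 C1 /cr_at_e2 C2 y; apply/cr_atE => v.
have tb := frame_table hF.
have [a1 b1] := C1 v; have [a2 c2] := C2 v.
have b2 : b (F i2 *m v) = - a (F i3 *m v).
  by have [+ _] := C1 (F i2 *m v); rewrite mulmxA tb; lra.
have b3 : b (F i3 *m v) = - c v.
  by have [+ _] := C1 (F i3 *m v); rewrite mulmxA tb mulNmx om12N; lra.
have c1 : c (F i1 *m v) = a (F i3 *m v).
  by have [+ _] := C2 (F i1 *m v); rewrite mulmxA tb mulNmx om12N; lra.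
have c3 : c (F i3 *m v) = - b v.
  by have [+ _] := C2 (F i3 *m v); rewrite mulmxA tb mulNmx om12N; lra.
by rewrite /= a1 b1 a2 c2 b2 b3 c1 c3; split; ring.
Qed.

(** With e = -1 the first two equations give b = a o F_1 and c = a o F_2, hence
    b o F_3 = a o (F_1 F_3) = - a o F_2 = - c, whereas the third one reads
    b o F_3 = c. *)
Lemma cr_at_anti : cr_at (-1) e1 -> cr_at (-1) e2 -> cr_at (-1) e3 ->
  forall v, om v = 0.
Proof.
move=> /cr_at_e1 C1 /cr_at_e2 C2 /cr_at_e3 C3 v; have tb := frame_table hF.
have c0 w : c w = 0.
  have [+ _] := C1 (F i3 *m w); have [+ _] := C2 w; have [+ _] := C3 w.
  by rewrite mulmxA tb mulNmx om12N; lra.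
have a0 w : a w = 0 by have [_ +] := C2 w; rewrite c0; lra.
have b0 w : b w = 0 by have [+ _] := C1 w; rewrite a0; lra.
apply/matrixP => k l; rewrite [RHS]mxE.
have -> : om v k l = ((delta_mx 0 k : 'rV[R]_3) *m om v) 0 l.
  by rewrite -rowE mxE.
by move: l; apply: forall_I3; rewrite row_om !(a0, b0, c0); ring.
Qed.

End HolomorphyAlgebra.

(** * The frame of an almost hyperhermitian structure in a chart *)

Section HyperhermitianChart.
Variables (R : realType) (M : manifold R 4) (g : components M)
  (J : 'I_3 -> components M).
Hypothesis hM : neutral_almost_hyperhermitian g J.
Variables (i : chart_index M).
Implicit Types (u v : 'cV[R]_4) (y : 'rV[R]_3).

Definition frame u : 'I_3 -> 'M[R]_4 := fun a => J a i u.

Definition frame_square (a : 'I_3) : R := if a == i1 then -1 else 1.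

Lemma near_chart u (P : 'cV[R]_4 -> Prop) : chart_img i u ->
  (forall x, chart_img i x -> P x) -> \forall x \near u, P x.
Proof.
move=> Uu UP; apply: filterS UP _; apply: open_nbhs_nbhs; split => //.
exact: chart_img_open.
Qed.

Lemma metric_sym u : chart_img i u -> (g i u)^T = g i u.
Proof. by case: hM => -[_ h] _ _ _ /h[]. Qed.

Lemma metric_unit u : chart_img i u -> g i u \in unitmx.
Proof.
case: hM => -[_ h] _ _ _ /h[_ [P uP PgP]].
have : P^T *m g i u *m P \in unitmx.
  rewrite PgP unitmxE det_diag unitfE; apply/prodf_neq0 => k _.
  by rewrite mxE; case: ifP => _; rewrite ?oppr_eq0 oner_eq0.
by rewrite !unitmx_mul => /andP[/andP[]].
Qed.

Lemma metric_unit_vector u : chart_img i u ->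
  exists x : 'cV[R]_4, bform (g i u) x x = 1.
Proof.
case: hM => -[_ h] _ _ _ /h[_ [P uP PgP]].
exists (P *m delta_mx 0 0); rewrite /bform trmx_mul.
rewrite !mulmxA -(mulmxA _ P^T) -(mulmxA _ _ P) PgP.
by rewrite trmx_delta -rowE -colE !mxE.
Qed.

Lemma metric_diff u : chart_img i u -> differentiable (g i) u.
Proof.
by case: hM => -[[sg _] _] _ _ _; exact: smooth_on_differentiable.
Qed.

Lemma J_diff a u : chart_img i u -> differentiable (J a i) u.
Proof.
case: hM => _ sJ _ _; have [+ _] := sJ a => /(_ i).
exact: smooth_on_differentiable.
Qed.

Lemma frame_quaternion u : chart_img i u -> split_quaternion_frame (frame u).
Proof. by case: hM => _ _ h _ /h. Qed.

Lemma J_square a u : chart_img i u -> J a i u *m J a i u = (frame_square a)%:M.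
Proof.
move=> /frame_quaternion[h1 h2 h3 _ _]; rewrite /frame in h1 h2 h3.
by move: a; apply: forall_I3; rewrite /frame_square /= ?raddfN.
Qed.

(** Compatibility with g and the value of J_a J_a combine to skewness, with the
    same sign for complex and product structures. *)
Lemma J_skew a u : chart_img i u -> form_skew (g i u) (J a i u).
Proof.
move=> Uu; have [h11 h22 _ _ _] := frame_quaternion Uu.
have sg := metric_sym Uu; case: hM => _ _ _ /(_ _ _ Uu)[c1 c2 _].
apply: (frame_skew (frame_quaternion Uu)) => //; rewrite /form_skew trmx_mul sg.
- by rewrite -{2}c1 -!mulmxA h11 !mulmxN mulmx1 opprK.
- by rewrite -[g i u in RHS]opprK -c2 mulNmx -!mulmxA h22 mulmx1 opprK.
Qed.

Lemma near_metric_sym u : chart_img i u -> \forall x \near u, (g i x)^T = g i x.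
Proof. by move=> Uu; apply: near_chart => // x; exact: metric_sym. Qed.

Lemma near_J_skew a u : chart_img i u ->
  \forall x \near u, form_skew (g i x) (J a i x).
Proof. by move=> Uu; apply: near_chart => // x; exact: J_skew. Qed.

Definition nablaJ u a v := cov (g i) u (J a i) v.

(** The connection form of D on E in the frame J. *)
Definition omega u v : 'M[R]_3 :=
  \matrix_(a, b) frame_coord (frame u) (nablaJ u a v) 0 b.

Section AtPoint.
Variable u : 'cV[R]_4.
Hypothesis Uu : chart_img i u.

Let dG := metric_diff Uu.
Let sG := near_metric_sym Uu.
Let uG := metric_unit Uu.

Lemma nablaJ_D a v w : nablaJ u a (v + w) = nablaJ u a v + nablaJ u a w.
Proof. by rewrite /nablaJ covD//; exact: J_diff. Qed.

Lemma nablaJ_Z a c v : nablaJ u a (c *: v) = c *: nablaJ u a v.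
Proof. by rewrite /nablaJ covZ//; exact: J_diff. Qed.

Lemma nablaJ_skew a v : form_skew (g i u) (nablaJ u a v).
Proof. by apply: cov_skew => //; [exact: J_diff|exact: near_J_skew]. Qed.

Lemma nablaJ_connection v : exists a b c : R,
  [/\ nablaJ u i1 v = a *: J i2 i u + b *: J i3 i u,
      nablaJ u i2 v = a *: J i1 i u + c *: J i3 i u
    & nablaJ u i3 v = b *: J i1 i u - c *: J i2 i u].
Proof.
have [x gx] := metric_unit_vector Uu.
have dJ a := J_diff a Uu.
have sq a : nablaJ u a v *m J a i u + J a i u *m nablaJ u a v = 0.
  rewrite /nablaJ -cov_mul//.
  rewrite (@cov_near _ _ (g i) u _ (fun=> (frame_square a)%:M)).
    exact: cov_scalar.
  by apply: near_chart => // z; exact: J_square.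
apply: (connection_matrix (metric_sym Uu) gx (frame_quaternion Uu)
  (fun a => J_skew a Uu) (nablaJ_skew^~ v)) => //.
- rewrite /nablaJ /frame -cov_mul//; apply: cov_near; apply: near_chart => // z.
  by case/frame_quaternion.
- apply: oppr_inj; rewrite opprK /nablaJ /frame -cov_mul// -covN//.
  apply: cov_near; apply: near_chart => // z.
  by case/frame_quaternion => _ _ _ _; rewrite /frame => <-; rewrite opprK.
Qed.

Lemma cr_defect_nablaJ a v : cr_defect (g i) u (J a i) v =
  nablaJ u a (J a i u *m v) - J a i u *m nablaJ u a v.
Proof. by []. Qed.

Lemma frameK y : frame_coord (frame u) (comb (frame u) y) = y.
Proof. exact/frame_coordK/frame_quaternion. Qed.

Lemma omegaE v a b :
  omega u v a b = frame_coord (frame u) (nablaJ u a v) 0 b.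
Proof. by rewrite mxE. Qed.

Lemma nablaJ_row a v : nablaJ u a v = comb (frame u) (row a (omega u v)).
Proof.
suff [w aw] : exists w, nablaJ u a v = comb (frame u) w.
  rewrite [LHS]aw; congr comb; apply/rowP => b.
  by rewrite mxE omegaE aw frameK.
have [p [q [r [h1 h2 h3]]]] := nablaJ_connection v.
have d b : comb (frame u) (delta_mx 0 b) = J b i u by rewrite comb_delta.
move: a; apply: forall_I3.
- by exists (p *: delta_mx 0 i2 + q *: delta_mx 0 i3); rewrite combD !combZ !d.
- by exists (p *: delta_mx 0 i1 + r *: delta_mx 0 i3); rewrite combD !combZ !d.
- exists (q *: delta_mx 0 i1 + - r *: delta_mx 0 i2).
  by rewrite combD !combZ !d scaleNr.
Qed.

Lemma nablaJ_comb y v :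
  \sum_a y 0 a *: nablaJ u a v = comb (frame u) (y *m omega u v).
Proof. by rewrite comb_mulmx; apply: eq_bigr => a _; rewrite nablaJ_row. Qed.

Lemma omega_so v : exists a b c : R, forall y : 'rV[R]_3,
  [/\ (y *m omega u v) 0 i1 = y 0 i2 * a + y 0 i3 * b,
      (y *m omega u v) 0 i2 = y 0 i1 * a - y 0 i3 * c
    & (y *m omega u v) 0 i3 = y 0 i1 * b + y 0 i2 * c].
Proof.
have [p [q [r [h1 h2 h3]]]] := nablaJ_connection v; exists p, q, r => y.
have d b : J b i u = comb (frame u) (delta_mx 0 b) by rewrite comb_delta.
have e1 b : omega u v i1 b =
    (p *: delta_mx 0 i2 + q *: delta_mx 0 i3 : 'rV[R]_3) 0 b.
  by rewrite omegaE h1 !d -!combZ -combD frameK.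
have e2 b : omega u v i2 b =
    (p *: delta_mx 0 i1 + r *: delta_mx 0 i3 : 'rV[R]_3) 0 b.
  by rewrite omegaE h2 !d -!combZ -combD frameK.
have e3 b : omega u v i3 b =
    (q *: delta_mx 0 i1 - r *: delta_mx 0 i2 : 'rV[R]_3) 0 b.
  by rewrite omegaE h3 -scaleNr !d -!combZ -combD frameK scaleNr.
have yE b : (y *m omega u v) 0 b =
    y 0 i1 * omega u v i1 b + y 0 i2 * omega u v i2 b + y 0 i3 * omega u v i3 b.
  by rewrite [LHS]mxE big_I3.
by rewrite !yE !e1 !e2 !e3 !mxE /=; split; ring.
Qed.

Lemma omegaD v w : omega u (v + w) = omega u v + omega u w.
Proof.
apply/matrixP => a b.
rewrite [LHS]omegaE nablaJ_D frame_coordD [LHS]mxE [RHS]mxE.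
by congr (_ + _); rewrite [RHS]omegaE. Qed.

Lemma omegaZ c v : omega u (c *: v) = c *: omega u v.
Proof.
apply/matrixP => a b.
rewrite [LHS]omegaE nablaJ_Z frame_coordZ [LHS]mxE [RHS]mxE.
by congr (_ * _); rewrite [RHS]omegaE. Qed.

Lemma cr_defect_cr_at a : (forall v, cr_defect (g i) u (J a i) v = 0) <->
  cr_at (frame u) (omega u) 1 (delta_mx 0 a).
Proof.
have hF := frame_quaternion Uu.
have Ja : J a i u = comb (frame u) (delta_mx 0 a) by rewrite comb_delta.
have defE v : cr_defect (g i) u (J a i) v =
    comb (frame u) (delta_mx 0 a *m omega u (J a i u *m v)) -
    comb (frame u) (cross3 (delta_mx 0 a) (delta_mx 0 a *m omega u v)).
  rewrite cr_defect_nablaJ; congr (_ - _); first by rewrite nablaJ_row rowE.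
  rewrite nablaJ_row rowE.
  rewrite [J a i u in LHS]Ja comb_mul// dot3_row_om ?raddf0 ?add0r//.
  exact: omega_so.
split=> h v.
  apply: (comb_inj hF); apply/eqP; rewrite scale1r -subr_eq0 comb_delta.
  by rewrite -defE h.
have := h v; rewrite comb_delta scale1r => hv.
by rewrite defE; apply/eqP; rewrite subr_eq0; apply/eqP; exact: congr1 hv.
Qed.

Lemma omega_parallel : (forall v, omega u v = 0) <->
  (forall a v, nablaJ u a v = 0).
Proof.
split=> [h a v|h v].
  rewrite nablaJ_row h linear0 /comb big1// => b _.
  by rewrite mxE scale0r.
by apply/matrixP => a b; rewrite !mxE h mul0mx linear0 mulr0.
Qed.

End AtPoint.

End HyperhermitianChart.

Section Integrability.
Variables (R : realType) (M : manifold R 4) (g : components M)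
  (J : 'I_3 -> components M).
Hypothesis hM : neutral_almost_hyperhermitian g J.

(** Constant vector fields already see the whole Nijenhuis tensor, and there
    the two Cauchy-Riemann defects are exchanged by a symmetry that a skew
    tensor cannot have. *)
Lemma integrable_cr_defect a : integrable_structure (J a) <->
  forall i u v, chart_img i u -> cr_defect (g i) u (J a i) v = 0.
Proof.
have nij i u X Y : chart_img i u -> differentiable X u -> differentiable Y u ->
    nijenhuis (J a i) X Y u = cr_defect (g i) u (J a i) (X u) *m Y u
                            - cr_defect (g i) u (J a i) (Y u) *m X u.
  move=> Uu dX dY; apply: nijenhuis_cr_defect => //.
  - exact (metric_diff hM Uu).
  - exact (near_metric_sym hM Uu).
  - exact (metric_unit hM Uu).
  - exact (J_diff hM _ Uu).
split=> [integ i u v Uu|def0 i X Y sX sY u Uu]; last first.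
  rewrite nij ?def0 ?mul0mx ?subrr//.
  - exact: smooth_on_differentiable sX Uu.
  - exact: smooth_on_differentiable sY Uu.
apply: (sym_skew_eq0 (metric_sym hM Uu) (metric_unit hM Uu)) => [x|x y].
  apply: (cr_defect_skew (metric_diff hM Uu)
    (near_metric_sym hM Uu) (metric_unit hM Uu)).
  - exact (J_diff hM _ Uu).
  - exact (near_J_skew hM _ Uu).
  - by apply: (near_chart Uu) => z Uz; exact (J_square hM _ Uz).
apply/eqP; rewrite -subr_eq0; apply/eqP.
have := nij i u (cst x) (cst y) Uu (differentiable_cst x u)
  (differentiable_cst y u).
by move=> <-; apply: integ => //; exact: smooth_on_cst.
Qed.

Lemma integrable_cr_at a : integrable_structure (J a) <->
  forall i u, chart_img i u ->
    cr_at (frame J i u) (omega g J i u) 1 (delta_mx 0 a).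
Proof.
rewrite integrable_cr_defect; split=> h i u => [Uu|v Uu].
  by apply/(cr_defect_cr_at hM Uu) => v; exact: h.
by move: v; apply/(cr_defect_cr_at hM Uu); exact: h.
Qed.

End Integrability.

(** * Curves on the hyperboloid *)

Section HyperboloidCurve.
Variable R : realType.
Implicit Types (y eta : 'rV[R]_3) (t : R).

(** A curve on the hyperboloid through y with velocity eta; in its rational
    parametrization the derivative at 0 needs no square root. *)
Definition hyp_curve y eta t : 'rV[R]_3 :=
  let q := dot3 eta eta / 4 in
  (1 - q * t ^+ 2)^-1 *: ((1 + q * t ^+ 2) *: y + t *: eta).

Lemma hyperboloid_dot3 y : hyperboloid y <-> dot3 y y = -1.
Proof. by rewrite /hyperboloid /dot3 /=; split=> h; lra. Qed.

Lemma hyp_curve0 y eta : hyp_curve y eta 0 = y.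
Proof.
rewrite /hyp_curve expr0n /= mulr0 subr0 addr0 invr1 !scale1r scale0r addr0 //.
Qed.

Lemma hyp_curve_hyperboloid y eta t : hyperboloid y -> dot3 y eta = 0 ->
  1 - dot3 eta eta / 4 * t ^+ 2 != 0 -> hyperboloid (hyp_curve y eta t).
Proof.
move=> /hyperboloid_dot3 yy ye; rewrite /hyp_curve; set q := _ / 4 => q0.
have ee : dot3 eta eta = 4 * q by rewrite /q; field.
apply/hyperboloid_dot3; set z := (_ *: y + _).
have zz : dot3 z z = - (1 - q * t ^+ 2) ^+ 2.
  have -> : dot3 z z = (1 + q * t ^+ 2) ^+ 2 * dot3 y y
      + 2 * (1 + q * t ^+ 2) * t * dot3 y eta + t ^+ 2 * dot3 eta eta.
    by rewrite /z /dot3 !mxE; ring.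
  by rewrite yy ye ee; ring.
have -> c : dot3 (c *: z) (c *: z) = c ^+ 2 * dot3 z z.
  by rewrite /dot3 !mxE; ring.
by rewrite zz; field.
Qed.

Lemma is_derive_scale_sq (q : R) :
  is_derive (0 : R) 1 (fun t => q * t ^+ 2 : R) 0.
Proof.
have := is_derive_mul (is_derive_cst q (0 : R) (1 : R))
  (is_derive_mul (is_derive_id (0 : R) (1 : R)) (is_derive_id (0 : R) (1 : R))).
by rewrite !(mul0r, mulr0, addr0).
Qed.

Lemma is_derive_hyp_den (q : R) :
  is_derive (0 : R) 1 (fun t => 1 - q * t ^+ 2 : R) 0.
Proof.
have dsq := is_derive_scale_sq q.
have := is_deriveB (is_derive_cst (1 : R) (0 : R) (1 : R)) dsq.
by rewrite subr0.
Qed.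

Lemma is_derive_dot3 (c : R -> 'rV[R]_3) eta :
  is_derive (0 : R) 1 c eta ->
  is_derive (0 : R) 1 (fun t => dot3 (c t) (c t)) (2 * dot3 (c 0) eta).
Proof.
move=> dc; have ck k := (is_derive_mxP _ _ _ _).1 dc 0 k.
have d : is_derive (0 : R) 1 (fun t => dot3 (c t) (c t)) _ :=
  is_deriveD (is_deriveD (is_deriveN (is_derive_mul (ck i1) (ck i1)))
     (is_derive_mul (ck i2) (ck i2))) (is_derive_mul (ck i3) (ck i3)).
by apply: (is_derive_eq d); rewrite /dot3; ring.
Qed.

Lemma is_derive_hyp_curve y eta : is_derive (0 : R) 1 (hyp_curve y eta) eta.
Proof.
rewrite /hyp_curve; set q := _ / 4.
have dsq := is_derive_scale_sq q.
have dnum : is_derive (0 : R) 1 (fun t => (1 + q * t ^+ 2) *: y + t *: eta) eta.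
  have d1 : is_derive (0 : R) 1 (fun t => 1 + q * t ^+ 2 : R) 0.
    have := is_deriveD (is_derive_cst (1 : R) (0 : R) (1 : R)) dsq.
    by rewrite addr0.
  have dy := is_derive_scalemx d1 (is_derive_cst y (0 : R) (1 : R)).
  have de := is_derive_scalemx (is_derive_id (0 : R) 1)
    (is_derive_cst eta (0 : R) (1 : R)).
  have d : is_derive (0 : R) 1 (fun t => (1 + q * t ^+ 2) *: y + t *: eta) _ :=
    is_deriveD dy de.
  apply: (is_derive_eq d).
  by rewrite !(scale0r, scaler0, scale1r, add0r, addr0).
have dden : is_derive (0 : R) 1 (fun t => (1 - q * t ^+ 2)^-1 : R) 0.
  have d1 := is_derive_hyp_den q.
  have n0 : 1 - q * (0 : R) ^+ 2 != 0 by rewrite expr0n mulr0 subr0 oner_eq0.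
  have [d1d d1e] := d1.
  have dV := @derivableV _ _ (fun t => 1 - q * t ^+ 2) 0 1 n0 d1d.
  have eV := @deriveV _ _ (fun t => 1 - q * t ^+ 2) 0 1 n0 d1d.
  by split; [exact dV|rewrite [LHS]eV d1e scaler0].
apply: (is_derive_eq (is_derive_scalemx dden dnum)).
by rewrite scale0r add0r expr0n /= mulr0 subr0 invr1 scale1r.
Qed.

End HyperboloidCurve.

Lemma xget_unique (T : choiceType) (x0 a : T) (P : set T) :
  P a -> (forall z, P z -> z = a) -> xget x0 P = a.
Proof. by move=> Pa Pu; case: xgetP => [z _ /Pu|/(_ a)]. Qed.

(** * The differential of the twistor projection *)

Section TwistorChart.
Variables (R : realType) (M : manifold R 4) (g : components M)
  (J : 'I_3 -> components M).
Hypothesis hM : neutral_almost_hyperhermitian g J.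
Variables (i : chart_index M).
Implicit Types (u v : 'cV[R]_4) (y eta : 'rV[R]_3).

Lemma frame_combE u y : frame_comb J i u y = comb (frame J i u) y.
Proof. by []. Qed.

Lemma E_coordK u y : chart_img i u -> E_coord J i u (frame_comb J i u y) = y.
Proof.
move=> Uu; apply: xget_unique => // z /= /(comb_inj (frame_quaternion hM Uu)).
by move=> ->.
Qed.

(** The twistor projection is a chosen coordinate vector, with an arbitrary
    value off E; this formula agrees with it on the twistor space and can be
    differentiated. *)
Definition twistor_coord (p : 'cV[R]_4 * 'M[R]_4) : 'rV[R]_3 :=
  frame_coord (frame J i p.1) p.2.

Lemma twistor_spaceE p : twistor_space J i p ->
  [/\ chart_img i p.1, hyperboloid (twistor_coord p),
      p.2 = comb (frame J i p.1) (twistor_coord p)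
    & twistor_proj J i p = twistor_coord p].
Proof.
case=> Up [y Hy py].
have py' : twistor_coord p = y.
  rewrite /twistor_coord py frame_combE.
  by rewrite (frame_coordK (frame_quaternion hM Up)).
by rewrite py' py /twistor_proj py E_coordK.
Qed.

(** The velocity of the curve with base point u(t) and coordinates y(t), where
    u' = v and y' = eta. *)
Definition twistor_vec u y v eta : 'cV[R]_4 * 'M[R]_4 :=
  (v, comb (frame J i u) eta + \sum_a y 0 a *: 'D_v (J a i) u).

Lemma twistor_vec_inj u y v eta eta' : chart_img i u ->
  twistor_vec u y v eta = twistor_vec u y v eta' -> eta = eta'.
Proof.
by move=> Uu [] /addIr; exact: comb_inj (frame_quaternion hM Uu) _ _.
Qed.

(** Every curve with velocity W gives the same eta by [twistor_vec_inj], so the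
    differential of the projection does not depend on the curve. *)
Lemma curve_twistor_vec s W c : curve_at (twistor_space J i) s W c ->
  exists eta, [/\ W = twistor_vec s.1 (twistor_coord s) W.1 eta,
    dot3 (twistor_coord s) eta = 0 &
    is_derive (0 : R) 1 (twistor_proj J i \o c) eta].
Proof.
case=> c0 nearZ dc.
have [Us _ sE _] : [/\ chart_img i s.1, hyperboloid (twistor_coord s),
    s.2 = comb (frame J i s.1) (twistor_coord s)
    & twistor_proj J i s = twistor_coord s].
  by apply: twistor_spaceE; rewrite -c0; exact: nbhs_singleton nearZ.
have d1 := is_derive_fst dc; have d2 := is_derive_snd dc.
have dJ a : is_derive (0 : R) 1 (fun t => J a i (c t).1)
    ('D_(W.1) (J a i) s.1).
  rewrite -c0; apply: (is_derive_curve_comp (f := J a i)) d1.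
  by rewrite c0; exact (J_diff hM _ Us).
have [eta deta] : exists eta,
    is_derive (0 : R) 1 (fun t => twistor_coord (c t)) eta.
  pose dco a := (if a == i1 then - 4^-1 else 4^-1) *
     \tr (W.2 *m J a i (c 0).1 + (c 0).2 *m 'D_(W.1) (J a i) s.1).
  exists (\row_a dco a); apply/is_derive_mxP => k a; rewrite mxE.
  under eq_fun do rewrite mxE.
  have := is_derive_mul
     (is_derive_cst (if a == i1 then - 4^-1 else 4^-1 : R) (0 : R) (1 : R))
     (is_derive_mxtrace (is_derive_mulmx d2 (dJ a))).
  by rewrite mul0r add0r.
have dproj : is_derive (0 : R) 1 (twistor_proj J i \o c) eta.
  apply: near_eq_is_derive deta.
  apply: filterS nearZ => t /twistor_spaceE[_ _ _].
  by move=> /= ->.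
exists eta; split => //.
- rewrite [LHS]surjective_pairing; congr pair.
  have dsum := is_derive_sum_scalemx
    (fun a => (is_derive_mxP _ _ _ _).1 deta 0 a) dJ.
  have d2' : is_derive (0 : R) 1 (fun t => (c t).2)
      (\sum_a eta 0 a *: J a i (c 0).1
       + \sum_a twistor_coord (c 0) 0 a *: 'D_(W.1) (J a i) s.1).
    apply: near_eq_is_derive dsum.
    apply: filterS nearZ => t /twistor_spaceE[_ _ + _].
    by move=> /= ->.
  by have [_ <-] := d2; have [_ ->] := d2'; rewrite c0.
- have hyp1 : is_derive (0 : R) 1
      (fun t => dot3 (twistor_coord (c t)) (twistor_coord (c t))) 0.
    apply: (near_eq_is_derive (f := fun=> -1 : R)).
    apply: filterS nearZ => t /twistor_spaceE[_ + _ _].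
    by move/hyperboloid_dot3.
  have [_ h1] := is_derive_dot3 deta; have [_ h0] := hyp1.
  by move: h1; rewrite h0 c0; lra.
Qed.

Lemma twistor_vec_tangent u y v eta : chart_img i u -> hyperboloid y ->
  dot3 y eta = 0 ->
  tangent (twistor_space J i) (u, comb (frame J i u) y) (twistor_vec u y v eta).
Proof.
move=> Uu Hy ye.
pose c (t : R) :=
  (u + t *: v, comb (frame J i (u + t *: v)) (hyp_curve y eta t)).
have du : is_derive (0 : R) 1 (fun t => u + t *: v) v.
  have := is_deriveD (is_derive_cst u (0 : R) (1 : R))
    (is_derive_scalemx (is_derive_id (0 : R) 1)
       (is_derive_cst v (0 : R) (1 : R))).
  by rewrite scaler0 addr0 add0r scale1r.
have u0 : u + 0 *: v = u by rewrite scale0r addr0.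
exists c; split.
- by rewrite /c u0 hyp_curve0.
- have near_u : \forall t \near (0 : R), chart_img i (u + t *: v).
    have [/derivable1_diffP/differentiable_continuous + _] := du.
    move=> /(_ (chart_img i)); apply; rewrite u0.
    by apply: (near_chart Uu).
  have near_q : \forall t \near (0 : R), 1 - dot3 eta eta / 4 * t ^+ 2 != 0.
    have cq : {for (0 : R),
        continuous (fun t : R => 1 - dot3 eta eta / 4 * t ^+ 2)}.
      apply: differentiable_continuous; apply/derivable1_diffP.
      by case: (is_derive_hyp_den (dot3 eta eta / 4)).
    move: cq => /(_ [set z | z != 0]); apply.
    apply: open_nbhs_nbhs; split; first exact: open_neq.
    by rewrite /= expr0n mulr0 subr0 oner_eq0.
  near=> t; split; first by near: t.
  exists (hyp_curve y eta t) => //; apply: hyp_curve_hyperboloid => //.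
  by near: t.
- apply: is_derive_pair => //.
  have dJ a : is_derive (0 : R) 1 (fun t => J a i (u + t *: v))
      ('D_v (J a i) u).
    rewrite -[X in 'D_v _ X]u0; apply: (is_derive_curve_comp (f := J a i)) du.
    by rewrite u0; exact (J_diff hM _ Uu).
  have := is_derive_sum_scalemx
    (fun a => (is_derive_mxP _ _ _ _).1 (is_derive_hyp_curve y eta) 0 a) dJ.
  by rewrite u0 hyp_curve0.
Unshelve. all: by end_near. Qed.

Lemma pushforward_twistor_vec u y v eta : chart_img i u -> hyperboloid y ->
  dot3 y eta = 0 ->
  twistor_proj_pushforward J i (u, comb (frame J i u) y) (twistor_vec u y v eta)
  = eta.
Proof.
move=> Uu Hy ye; set s := (u, _); set W := twistor_vec _ _ _ _.
have ys : twistor_coord s = y by exact: frame_coordK (frame_quaternion hM Uu) _.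
have key c : curve_at (twistor_space J i) s W c ->
    is_derive (0 : R) 1 (twistor_proj J i \o c) eta.
  case/curve_twistor_vec => eta' [+ _ d]; rewrite ys => /twistor_vec_inj.
  by move=> /(_ Uu) ->.
apply: xget_unique => [|z [c /key[_ <-] [_ <-]]//].
by have [c cW] := twistor_vec_tangent v Uu Hy ye; exists c => //; exact: key.
Qed.

(** Moving horizontally keeps S parallel, so that the coordinates of S change by
    minus the connection form. *)
Lemma hlift_twistor u y v : chart_img i u ->
  hlift g i (u, comb (frame J i u) y) v =
  twistor_vec u y v (- (y *m omega g J i u v)).
Proof.
move=> Uu; rewrite /hlift /twistor_vec /=; congr pair.
have <- : \sum_a (- y) 0 a *: nablaJ g J i u a v =
    comb (frame J i u) (- (y *m omega g J i u v)).
  by rewrite nablaJ_comb// mulNmx.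
rewrite -big_split /= /comb mulmx_sumr mulmx_suml -sumrB -sumrN.
apply: eq_bigr => a _; rewrite /nablaJ /cov /cov_end mxE /frame.
rewrite -scalemxAl -scalemxAr -scalerBr -scalerN scaleNr -scalerN -scalerDr.
by congr (_ *: _); mx_abel.
Qed.

Lemma twistor_vec_vertical u y v eta zeta :
  twistor_vec u y v eta + (0, comb (frame J i u) zeta) =
  twistor_vec u y v (eta + zeta).
Proof. by rewrite /twistor_vec combD; congr pair; rewrite ?addr0// addrAC. Qed.

(** The vector is v^h plus the vertical vector with coordinates
    eta + y omega(v), and its image is the lift of S v plus the rotated vertical
    vector. *)
Lemma twistor_J_vec k u y v eta : chart_img i u -> hyperboloid y ->
  dot3 y eta = 0 ->
  twistor_J g J i k (u, comb (frame J i u) y) (twistor_vec u y v eta) =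
  twistor_vec u y (comb (frame J i u) y *m v)
    ((-1) ^+ k.-1 *: cross3 y (eta + y *m omega g J i u v)
     - y *m omega g J i u (comb (frame J i u) y *m v)).
Proof.
move=> Uu Hy ye; set s := (u, _); set om := omega g J i u.
have EyK z : E_coord J i u (comb (frame J i u) z) = z by exact: E_coordK.
have value X zeta : hlift g i s (s.2 *m X) +
    (0, (-1) ^+ k.-1 *: E_cross J i s.1 s.2 (comb (frame J i u) zeta)) =
    twistor_vec u y (s.2 *m X)
      ((-1) ^+ k.-1 *: cross3 y zeta - y *m om (s.2 *m X)).
  rewrite hlift_twistor// /E_cross /= !EyK frame_combE -combZ.
  by rewrite twistor_vec_vertical addrC.
apply: xget_unique => /= [|W' [X [V [[[zeta ->] _] + ->]]]].
  exists v, (comb (frame J i u) (eta + y *m om v)); split.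
  - split; first by exists (eta + y *m om v).
    rewrite /E_dot /= !EyK dot3D ye add0r; apply: dot3_row_om.
    exact (omega_so hM Uu).
  - by rewrite hlift_twistor// twistor_vec_vertical [- _ + _]addrC addrK.
  - by rewrite value.
rewrite frame_combE hlift_twistor// twistor_vec_vertical => eW.
have vX : v = X by have := congr1 fst eW.
rewrite -{}vX in eW *; have {eW} := twistor_vec_inj Uu eW => ->.
by rewrite value addrAC addNr add0r.
Qed.

End TwistorChart.

(** * Holomorphy of the projection *)

Section MainEquivalence.
Variables (R : realType) (M : manifold R 4) (g : components M)
  (J : 'I_3 -> components M).
Hypothesis hM : neutral_almost_hyperhermitian g J.

(** On both sides of the equation for p_* the vertical velocity eta enters as
    (-1)^(k-1) y x eta; without it the equation is [cr_at], and horizontal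
    and arbitrary tangent vectors impose the same condition. *)
Lemma twistor_proj_cr_at k :
  (forall i s W, twistor_space J i s -> tangent (twistor_space J i) s W ->
    twistor_proj_pushforward J i s (twistor_J g J i k s W) =
    (-1) ^+ k.-1 *:
      cross3 (twistor_proj J i s) (twistor_proj_pushforward J i s W)) <->
  (forall i u, chart_img i u -> forall y, hyperboloid y ->
    cr_at (frame J i u) (omega g J i u) ((-1) ^+ k.-1) y).
Proof.
have step i u y v eta : chart_img i u -> hyperboloid y -> dot3 y eta = 0 ->
  let s := (u, comb (frame J i u) y) in
  let W := twistor_vec J i u y v eta in
  [/\ twistor_proj_pushforward J i s (twistor_J g J i k s W) =
        (-1) ^+ k.-1 *: cross3 y (eta + y *m omega g J i u v)
        - y *m omega g J i u (comb (frame J i u) y *m v),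
      twistor_proj J i s = y & twistor_proj_pushforward J i s W = eta].
  move=> Uu Hy ye s W; split; last exact: (pushforward_twistor_vec hM).
    rewrite (twistor_J_vec hM)// (pushforward_twistor_vec hM)//.
    have so v' : dot3 y (y *m omega g J i u v') = 0.
      by apply: dot3_row_om; exact (omega_so hM Uu).
    by rewrite dot3D dot3N so dot3Z dot3_cross mulr0 subr0.
  exact: (E_coordK hM).
split=> [hol i u Uu y Hy v|cr i s W Zs tW].
  have y0 : dot3 y (0 : 'rV[R]_3) = 0 by rewrite /dot3 !mxE; ring.
  have [pJ py p0] := step i u y v 0 Uu Hy y0.
  have := hol i (u, comb (frame J i u) y) (twistor_vec J i u y v 0).
  rewrite pJ py p0 add0r => /(_ _ _)/eqP.
  rewrite -[cross3 y 0](_ : 0 = _); last first.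
    by apply: rV3P; rewrite !(cross3E, mxE); ring.
  rewrite scaler0 subr_eq0 eq_sym => h; apply/eqP/h; last first.
    exact: (twistor_vec_tangent hM).
  by split => //; exists y.
have [Us Hy sE ps] := twistor_spaceE hM Zs.
case: tW => c /(curve_twistor_vec hM)[eta [WE ye _]].
have sE' : s = (s.1, comb (frame J i s.1) (twistor_coord J i s)).
  by rewrite -sE -surjective_pairing.
have [+ +] := step i s.1 _ W.1 eta Us Hy ye.
rewrite -sE' -WE => -> -> ->; rewrite [X in _ - X](cr i s.1 Us _ Hy W.1).
rewrite -scalerBr; congr (_ *: _).
by rewrite cross3D addrK.
Qed.

End MainEquivalence.

Theorem theorem3 (R : realType) (M : manifold R 4) (g : components M)
    (J : 'I_3 -> components M) (hM : neutral_almost_hyperhermitian g J) :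
  (twistor_proj_holomorphic g J 1 <-> neutral_hyperhermitian J) /\
  (twistor_proj_antiholomorphic g J 2 <-> neutral_hyperkahler g J).
Proof.
have int_cr := integrable_cr_at hM.
have holE : twistor_proj_holomorphic g J 1 <-> forall i u, chart_img i u ->
    forall y, hyperboloid y -> cr_at (frame J i u) (omega g J i u) 1 y.
  rewrite -(twistor_proj_cr_at hM 1).
  by split=> h i s W Zs tW; have := h i s W Zs tW; rewrite scale1r.
have antE : twistor_proj_antiholomorphic g J 2 <-> forall i u, chart_img i u ->
    forall y, hyperboloid y -> cr_at (frame J i u) (omega g J i u) (-1) y.
  rewrite -[X in _ <-> X](twistor_proj_cr_at hM 2).
  by split=> h i s W Zs tW; have := h i s W Zs tW; rewrite expr1 scaleN1r.
have par0 : (forall a, parallel_structure g (J a)) <->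
    (forall i u, chart_img i u -> forall v, omega g J i u v = 0).
  split=> [h i u Uu|h a i u v Uu].
    by apply/(omega_parallel hM Uu) => a v; exact: h.
  by have /(omega_parallel hM Uu) := h i u Uu; exact.
split.
  rewrite holE; split=> [cr a|herm i u Uu y _].
    apply/int_cr => i u Uu.
    have [+ + +] := cr_at_basis (omegaD hM Uu)
      (omegaZ hM Uu) (omega_so hM Uu) (cr i u Uu).
    by move: a; exact: forall_I3.
  apply: (cr_at_all (frame_quaternion hM Uu) (omegaD hM Uu) (omegaZ hM Uu)
    (omega_so hM Uu)); exact: (int_cr _).1.
rewrite antE; split=> [cr|[_ /par0 om0] i u Uu y _ v]; last first.
  rewrite !om0// !mulmx0; apply: rV3P; rewrite !(cross3E, mxE); ring.
have om0 i u : chart_img i u -> forall v, omega g J i u v = 0.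
  move=> Uu; have [b1 b2 b3] := cr_at_basis
    (omegaD hM Uu) (omegaZ hM Uu) (omega_so hM Uu) (cr i u Uu).
  exact: (cr_at_anti (frame_quaternion hM Uu) (omegaD hM Uu) (omegaZ hM Uu)
    (omega_so hM Uu) b1 b2 b3).
split; last exact/par0.
move=> a; apply/int_cr => i u Uu v; rewrite !om0// !mulmx0.
by apply: rV3P; rewrite !(cross3E, mxE); ring.
Qed.
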